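(* Let $s\ge 1$ be an integer, let $h>0$, and let $f$ be a function on $[-1,1]^s$ that is analytic (after analytic continuation if necessary) in the region $$\{\boldsymbol{x}=(x_1,\dots,x_s)\in\mathbb{C}^s : x_1^2+\cdots+x_s^2\in N_{s,h^2}\}.$$ Set $\rho = h+\sqrt{1+h^2}$. Then, as $n\to\infty$, $$ \inf_{d(p)\le n}\|f-p\|_{[-1,1]^s} =\begin{cases} O_{\varepsilon}(\rho^{-n/\sqrt{s}}) & \text{if } d=d_T,\\ O_{\varepsilon}(\rho^{-n}) & \text{if } d=d_E,\\ O_{\varepsilon}(\rho^{-n}) & \text{if } d=d_{\max}, \end{cases} $$ where in each case the infimum is over all polynomials $p$ in the $s$ variables $x_1,\dots,x_s$ with $d(p)\le n$.
   Context: For real $s,a>0$, $N_{s,a}$ denotes the open region in the complex plane bounded by the ellipse with foci $0$ and $s$ and leftmost point $-a$; equivalently, $N_{s,a}=\{z\in\mathbb{C} : |z|+|z-s|<s+2a\}$. $\|\cdot\|_{[-1,1]^s}$ is the maximum norm over $[-1,1]^s$. For a monomial $x_1^{k_1}\cdots x_s^{k_s}$ with exponent vector $\boldsymbol{k}=(k_1,\dots,k_s)$ of nonnegative integers, the total degree is $d_T=\|\boldsymbol{k}\|_1=k_1+\cdots+k_s$, the Euclidean degree is $d_E=\|\boldsymbol{k}\|_2=(k_1^2+\cdots+k_s^2)^{1/2}$ (not necessarily an integer), and the max degree is $d_{\max}=\|\boldsymbol{k}\|_\infty=\max_j k_j$. For each of these notions, the degree of a multivariate polynomial is the maximum of the degrees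 of its nonzero monomial constituents. Notation $O_\varepsilon$: for $a>0$, $g(n)=O_\varepsilon(a^n)$ means that for every $\varepsilon>0$, $g(n)=O((a+\varepsilon)^n)$ as $n\to\infty$. $O_\varepsilon(a^{-n})$ means $O_\varepsilon((1/a)^n)$; similarly $O_\varepsilon(\rho^{-n/\sqrt{s}})$ means $O_\varepsilon((\rho^{-1/\sqrt{s}})^n)$. That $f$ is analytic in a region means that, if necessary, $f$ can be analytically continued to that region. *)

(* Defs.v *)
From HB Require Import structures.
From mathcomp Require Import all_boot all_order all_algebra.
From mathcomp Require Import all_classical all_reals all_analysis.
From mathcomp Require Import complex summability.
(* The notations of [mpoly] are incompatible with those of MathComp-Analysis:
   [multinom s] is the type written 'X_{1..s} there, [mpoly s K] is {mpoly K[s]}. *)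
From mathcomp Require Import -(notations) mpoly.

Set Implicit Arguments.
Unset Strict Implicit.
Unset Printing Implicit Defensive.

Import Order.TTheory GRing.Theory Num.Theory.
Import numFieldNormedType.Exports.

Local Open Scope classical_set_scope.
Local Open Scope ring_scope.
Local Open Scope complex_scope.

(* The modulus as an element of [R]; the generic norm [`|z|] of [R[i]] is its
   image in [R[i]]. *)
Local Notation normc := ComplexField.Normc.normc.

Definition monomial {R : realType} {s : nat} (x : 'rV[R[i]]_s)
    (k : multinom s) : R[i] :=
  \prod_(j < s) x ord0 j ^+ k j.

(* On a polydisc around [a], [F] is the sum of a power series.  The limit along
   [totally] is over the directed set of finite sets of multi-indices, i.e. the
   series converges unconditionally (equivalently, absolutely). *)
Definition analytic_at {R : realType} {s : nat} (F : 'rV[R[i]]_s -> R[i])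
    (a : 'rV[R[i]]_s) : Prop :=
  exists (r : R) (c : multinom s -> R[i]), 0 < r /\
    forall z : 'rV[R[i]]_s, (forall j, normc (z ord0 j - a ord0 j) < r) ->
      partial_sum (fun k => c k * monomial (z - a) k : R[i]^o) J @[J --> totally]
        --> (F z : R[i]^o).

Definition analytic_in {R : realType} {s : nat} (D : set 'rV[R[i]]_s)
    (F : 'rV[R[i]]_s -> R[i]) : Prop :=
  forall a, D a -> analytic_at F a.

(* N_{t,a}: the interior of the ellipse with foci 0, t and leftmost point -a. *)
Definition ellipse {R : realType} (t a : R) : set R[i] :=
  [set z | normc z + normc (z - t%:C) < t + 2 * a].

Definition region {R : realType} (s : nat) (h : R) : set 'rV[R[i]]_s :=
  [set x | ellipse s%:R (h ^+ 2) (\sum_(j < s) x ord0 j ^+ 2)].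

Definition cube {R : realType} {s : nat} : set 'rV[R]_s :=
  [set x | forall j, x ord0 j \in `[-1, 1]].

Definition complexify {R : realType} {s : nat} (x : 'rV[R]_s) : 'rV[R[i]]_s :=
  \row_j (x ord0 j)%:C.

(* For [g] continuous the supremum is a maximum; the value 0 that [sup] takes on
   unbounded sets plays no role then. *)
Definition cube_norm {R : realType} {s : nat} (g : 'rV[R]_s -> R[i]) : R :=
  sup [set normc (g x) | x in cube].

Definition poly_fun {R : realType} {s : nat} (p : mpoly s R[i])
    (x : 'rV[R]_s) : R[i] :=
  meval (complexify x ord0) p.

Definition degT {R : realType} {s : nat} (k : multinom s) : R := (mdeg k)%:R.

Definition degE {R : realType} {s : nat} (k : multinom s) : R :=
  Num.sqrt (\sum_(j < s) (k j)%:R ^+ 2).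

Definition degmax {R : realType} {s : nat} (k : multinom s) : R :=
  (\max_(j < s) k j)%:R.

(* Convention: the zero polynomial has degree 0. *)
Definition poly_deg {R : realType} {s : nat} (d : multinom s -> R)
    (p : mpoly s R[i]) : R :=
  \big[Num.max/0]_(k <- msupp p) d k.

Definition best_error {R : realType} {s : nat} (d : multinom s -> R)
    (f : 'rV[R]_s -> R[i]) (n : nat) : R :=
  inf [set cube_norm (fun x => f x - poly_fun p x)
      | p in [set p : mpoly s R[i] | poly_deg d p <= n%:R]].

(* g(n) = O_eps(a^n) *)
Definition Oeps {R : realType} (g : nat -> R) (a : R) : Prop :=
  forall e : R, 0 < e -> g =O_\oo (fun n => (a + e) ^+ n).

(* Main.v *)
Require Import Defs.
From HB Require Import structures.
From mathcomp Require Import all_boot all_order all_algebra.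
From mathcomp Require Import all_classical all_reals all_analysis.
From mathcomp Require Import complex summability finmap ring lra.
From mathcomp Require Import -(notations) mpoly.

(** Put x_i = J(z_i) with J(z) = (z + 1/z)/2.  The torus |z_i| = 1 covers the
    cube, and the Chebyshev polynomial of degree m takes at J(z) the value
    (z^m + z^-m)/2.  If |z_i| = exp(- b_i), the parallelogram law gives
    |x_i^2| + |x_i^2 - 1| = 1 + 2 sinh(b_i)^2, so x stays in the region of
    analyticity as long as the sum of the sinh(b_i)^2 is less than h^2.  The
    k-th Chebyshev coefficient is, up to a power of 2, the mean of F(J(z)) z^k
    over the torus; moving
    the torus to the radii exp(- b_i) with b_i = y k_i / |k|, where |k| is the
    Euclidean norm and sinh y < h, bounds it by a constant times
    exp(- sum_i b_i k_i) = exp(- y |k|).  These radii are admissible because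
    sinh(l y) <= l sinh(y) for 0 <= l <= 1 ([cosh_scale_le], [gauge_radii]).
    The condition sinh y < h means exp y < rho, so keeping the terms with
    |k| <= X leaves an error of order r^-X for every r < rho.  This is the
    Euclidean case.  The other two follow from degmax <= degE and from
    degT <= sqrt s * degE ([degT_le_degE]).

    All means are averages over finite grids of roots of unity, and two errors
    have to be controlled: that of moving the grid and that of replacing F by
    a finite expansion.

    Moving the grid is Cauchy's theorem in finite form.  The trapezoidal sum
    of a function around a small quadrilateral with vertices z, zw, zr, zwr is
    of third order in the side as soon as the function is linear up to a
    second-order error ([nearly_linear_square]).  The contributions of the
    sides joining two consecutive tori cancel around the grid, so one radial
    step changes the mean at second order ([grid_mean_shift_step]); the number
    of steps is inversely proportional to the side, and the total change tends
    to 0 as the grid is refined ([grid_mean_shift], [grid_coef_decay]).  The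
    second-order estimates come from the local power series
    ([analytic_at_local]) and are uniform by compactness ([uniform_analytic]).

    The finite expansion is a Fejer mean over the grid ([fejer_mean]).  Its
    kernel is positive, has mean 1 and is concentrated, so it approximates
    the Lipschitz function F on the cube ([fejer_mean_error]), while its
    expansion in Chebyshev polynomials only involves the grid coefficients
    ([fejer_mean_cheb_val]).  The order of the mean and the size of the grid
    are chosen last, in terms of the accuracy wanted, and the approximating
    polynomial is the part of the mean of Euclidean degree at most X
    ([chebyshev_approximation]). *)

Set Implicit Arguments.
Unset Strict Implicit.
Unset Printing Implicit Defensive.

Import Order.TTheory GRing.Theory Num.Theory.
Import numFieldNormedType.Exports.
Local Open Scope classical_set_scope.
Local Open Scope ring_scope.
Local Open Scope complex_scope.

Local Notation normc := ComplexField.Normc.normc.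

(** * Moduli of complex numbers and functions linear to second order *)

Section Modulus.
Context {R : rcfType}.
Implicit Types (z w : R[i]) (r : R).

Lemma normc_norm z : `|z| = (normc z)%:C.
Proof. by case: z => a b; rewrite normc_def. Qed.

Lemma normc_ge0 z : 0 <= normc z.
Proof. by case: z => a b; rewrite /normc sqrtr_ge0. Qed.

Lemma normc_real r : normc r%:C = `|r|.
Proof. by rewrite /normc /= expr0n addr0 sqrtr_sqr. Qed.

Lemma normc_nat n : normc (n%:R : R[i]) = n%:R.
Proof. by rewrite -(rmorph_nat (real_complex R)) normc_real normr_nat. Qed.

Lemma normc0r : normc (0 : R[i]) = 0.
Proof. exact: ComplexField.Normc.normc0. Qed.

Lemma normc1r : normc (1 : R[i]) = 1.
Proof. exact: ComplexField.Normc.normc1. Qed.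

Lemma normcM z w : normc (z * w) = normc z * normc w.
Proof. exact: ComplexField.Normc.normcM. Qed.

Lemma normcV z : normc z^-1 = (normc z)^-1.
Proof. exact: ComplexField.Normc.normcV. Qed.

Lemma normcN z : normc (- z) = normc z.
Proof. by rewrite -mulN1r normcM -(rmorphN1 (real_complex R)) normc_real normrN1 mul1r. Qed.

Lemma normcB z w : normc (z - w) = normc (w - z).
Proof. by rewrite -normcN opprB. Qed.

Lemma ler_normcD z w : normc (z + w) <= normc z + normc w.
Proof. by rewrite -lecR rmorphD/= -!normc_norm ler_normD. Qed.

Lemma ler_normcB z w : normc (z - w) <= normc z + normc w.
Proof. by rewrite -[normc w]normcN ler_normcD. Qed.

Lemma normcX z n : normc (z ^+ n) = normc z ^+ n.
Proof. by elim: n => [|n IH]; rewrite ?normc1r // !exprS normcM IH. Qed.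

Lemma normc_eq0 z : (normc z == 0) = (z == 0).
Proof.
apply/eqP/eqP => [|->]; last exact: normc0r.
exact: ComplexField.Normc.eq0_normc.
Qed.

Lemma normc_sum (I : Type) (r : seq I) (P : pred I) (G : I -> R[i]) :
  normc (\sum_(i <- r | P i) G i) <= \sum_(i <- r | P i) normc (G i).
Proof.
elim/big_ind2: _ => [|z1 a1 z2 a2 h1 h2|//]; first by rewrite normc0r.
exact: le_trans (ler_normcD _ _) (lerD h1 h2).
Qed.

Lemma normc_prod (I : Type) (r : seq I) (P : pred I) (G : I -> R[i]) :
  normc (\prod_(i <- r | P i) G i) = \prod_(i <- r | P i) normc (G i).
Proof. by elim/big_rec2: _ => [|i x y _ <-]; rewrite ?normc1r ?normcM. Qed.

Lemma normcM_le z w a b : normc z <= a -> normc w <= b -> normc (z * w) <= a * b.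
Proof. by move=> za wb; rewrite normcM ler_pM ?normc_ge0. Qed.

Lemma normcD_le z w a b : normc z <= a -> normc w <= b -> normc (z + w) <= a + b.
Proof. by move=> za wb; apply: le_trans (ler_normcD _ _) (lerD za wb). Qed.

Lemma normcB_le z w a b : normc z <= a -> normc w <= b -> normc (z - w) <= a + b.
Proof. by move=> za wb; apply: le_trans (ler_normcB _ _) (lerD za wb). Qed.

End Modulus.

Section NearlyLinear.
Context {R : rcfType}.
Implicit Types (H : R[i] -> R[i]) (C d : R).

(** Complex differentiability with a second-order remainder, where the slope
    may depend on the scale [t].  In this form the property passes to pointwise
    limits of power series without identifying the derivative of the limit,
    and it is still stable under products and compositions. *)
Definition nearly_linear C d H := forall t : R, 0 < t <= d ->
  exists2 L, normc L <= C &
  forall v, normc v <= t -> normc (H v - H 0 - L * v) <= C * t ^+ 2.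

Lemma nearly_linear_le C C' d d' H : C <= C' -> d' <= d ->
  nearly_linear C d H -> nearly_linear C' d' H.
Proof.
move=> CC dd HL t /andP[t0 td]; have [|L LC HL'] := HL t.
  by rewrite t0 (le_trans td).
exists L; first exact: le_trans CC.
by move=> v vt; apply: le_trans (HL' v vt) _; rewrite ler_wpM2r ?sqr_ge0.
Qed.

(** The scale [normc v] itself provides a slope, whence a Lipschitz bound. *)
Lemma nearly_linear_lip C d H v : 0 <= C -> d <= 1 -> nearly_linear C d H ->
  normc v <= d -> normc (H v - H 0) <= 2 * C * normc v.
Proof.
move=> C0 d1 HL vd; have [->|v0] := eqVneq v 0.
  by rewrite subrr normc0r mulr0.
have vp : 0 < normc v by rewrite lt_def normc_eq0 v0 normc_ge0.
have [|L LC /(_ v (lexx _)) H1] := HL (normc v); first by rewrite vp.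
have -> : H v - H 0 = (H v - H 0 - L * v) + L * v by ring.
have h2 : normc (L * v) <= C * normc v by rewrite normcM ler_wpM2r ?normc_ge0.
apply: le_trans (normcD_le H1 h2) _.
suff : C * normc v ^+ 2 <= C * normc v by lra.
rewrite ler_wpM2l // expr2 ler_piMr ?normc_ge0 //; exact: le_trans d1.
Qed.

Lemma nearly_linearM C1 C2 d H1 H2 : 1 <= C1 -> 1 <= C2 -> d <= 1 ->
  normc (H1 0) <= C1 -> normc (H2 0) <= C2 ->
  nearly_linear C1 d H1 -> nearly_linear C2 d H2 ->
  nearly_linear (6 * (C1 * C2)) d (fun v => H1 v * H2 v).
Proof.
move=> C1g C2g d1 h1 h2 HL1 HL2 t td.
have [L1 L1C HL1'] := HL1 t td; have [L2 L2C HL2'] := HL2 t td.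
case/andP: td => t0 td; have t1 : t <= 1 by exact: le_trans d1.
have CC : 1 <= C1 * C2 by rewrite -[1]mulr1 ler_pM.
exists (H1 0 * L2 + L1 * H2 0).
  by apply: le_trans (normcD_le (normcM_le h1 L2C) (normcM_le L1C h2)) _; lra.
move=> v vt; have {HL1'} := HL1' v vt; have {HL2'} := HL2' v vt.
set r2 := _ - L2 * v => r2C; set r1 := _ - L1 * v => r1C.
have -> : H1 v * H2 v - H1 0 * H2 0 - (H1 0 * L2 + L1 * H2 0) * v =
  L1 * L2 * (v * v) + (H1 0 + L1 * v) * r2 + r1 * (H2 0 + L2 * v) + r1 * r2.
  by rewrite /r1 /r2; ring.
have e1 := normcM_le (normcM_le L1C L2C) (normcM_le vt vt).
have e2 := normcM_le (normcD_le h1 (normcM_le L1C vt)) r2C.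
have e3 := normcM_le r1C (normcD_le h2 (normcM_le L2C vt)).
have e4 := normcM_le r1C r2C.
apply: le_trans (normcD_le (normcD_le (normcD_le e1 e2) e3) e4) _.
have t2 : t ^+ 2 <= 1 by rewrite expr_le1 // ltW.
have X0 : 0 <= C1 * C2 * t ^+ 2 by rewrite mulr_ge0 ?sqr_ge0 // (le_trans _ CC).
have -> : C1 * C2 * (t * t) + (C1 + C1 * t) * (C2 * t ^+ 2) +
  C1 * t ^+ 2 * (C2 + C2 * t) + C1 * t ^+ 2 * (C2 * t ^+ 2) =
  C1 * C2 * t ^+ 2 * (3 + 2 * t + t ^+ 2) by ring.
have -> : 6 * (C1 * C2) * t ^+ 2 = C1 * C2 * t ^+ 2 * 6 by ring.
rewrite ler_wpM2l //; lra.
Qed.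

Lemma nearly_linear_cst C d (c : R[i]) H : normc c <= 1 -> 0 <= C ->
  nearly_linear C d H -> nearly_linear C d (fun v => c * H v).
Proof.
move=> c1 C0 HL t td; have [L LC HL'] := HL t td; exists (c * L).
  by rewrite -[C]mul1r normcM_le.
move=> v vt; rewrite -mulrA -!mulrBr -[X in _ <= X]mul1r.
by rewrite normcM_le // HL'.
Qed.

(** At scale [t] the inner function moves by at most [2 * A * t], so the slope
    of [H] at that larger scale is the one to use. *)
Lemma nearly_linear_comp C d A H (w : R[i] -> R[i]) (l : R[i]) :
  0 <= C -> 1 <= A -> normc l <= A -> w 0 = 0 ->
  (forall v, normc v <= 2^-1 -> normc (w v - l * v) <= A * normc v ^+ 2) ->
  nearly_linear C d H ->
  nearly_linear (C * (4 * A ^+ 2 + A)) (Num.min 2^-1 (d / (2 * A))) (H \o w).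
Proof.
move=> C0 A1 lA w0 wl HL t; rewrite le_min => /andP[t0 /andP[t2 td]].
have A0 : 0 < A by exact: lt_le_trans A1.
have [|L LC HL'] := HL (2 * A * t).
  by rewrite !mulr_gt0 //= mulrC -ler_pdivlMr // mulr_gt0.
exists (L * l).
  apply: le_trans (normcM_le LC lA) _; rewrite ler_wpM2l //.
  by rewrite lerDr mulr_ge0 ?sqr_ge0.
move=> v vt /=; rewrite w0.
have v2 : normc v <= 2^-1 by exact: le_trans t2.
have e1 : normc (w v - l * v) <= A * t ^+ 2.
  apply: le_trans (wl v v2) _; rewrite ler_wpM2l ?(ltW A0) //.
  by rewrite lerXn2r ?nnegrE ?normc_ge0 ?(ltW t0).
have wt : normc (w v) <= 2 * A * t.
  have -> : w v = (w v - l * v) + l * v by ring.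
  apply: le_trans (normcD_le e1 (normcM_le lA vt)) _.
  have : A * t ^+ 2 <= A * t.
    by rewrite ler_wpM2l ?(ltW A0) // expr2 ler_piMr ?(ltW t0) //; lra.
  lra.
have -> : H (w v) - H 0 - L * l * v = (H (w v) - H 0 - L * w v) + L * (w v - l * v).
  by ring.
apply: le_trans (normcD_le (HL' _ wt) (normcM_le LC e1)) _.
by rewrite le_eqVlt; apply/orP; left; apply/eqP; ring.
Qed.

(** Both this remainder and the derivative below are compared with
    [(q + d) ^+ n], the same monomial at a larger radius; unlike factors growing
    with [n], this costs nothing when summed over a power series. *)
Lemma expnD_taylor (b v : R[i]) (q d : R) n : 0 <= q -> 0 < d ->
  normc b <= q -> normc v <= d ->
  normc ((b + v) ^+ n - b ^+ n - b ^+ n.-1 *+ n * v) <=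
    (normc v / d) ^+ 2 * (q + d) ^+ n.
Proof.
move=> q0 d0 bq vd; case: n => [|[|n]].
- rewrite !expr0 subrr mulr0n mul0r subrr normc0r mulr1; exact: sqr_ge0.
- rewrite [X in normc X](_ : _ = 0); last by rewrite /= expr0; ring.
  by rewrite normc0r mulr_ge0 ?sqr_ge0 // addr_ge0 // ltW.
rewrite exprDn 2!big_ord_recl /= /bump /= !addn0 !subn0 bin0 bin1 mulr1n expr0 mulr1.
rewrite expr1 subSS subn0 !mulrnAl.
set S := \sum_(i < _) _; set u := _ *+ n.+2.
rewrite [X in normc X](_ : _ = S); last by ring.
rewrite {}/S {u}.
rewrite [(q + d) ^+ _]exprDn [X in _ * X]big_ord_recl [X in _ * (_ + X)]big_ord_recl.
rewrite /= /bump /= mulrDr.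
apply: le_trans (normc_sum _ _ _) _.
rewrite -[X in X <= _]add0r lerD //.
  by rewrite mulr_ge0 ?sqr_ge0 // mulrn_wge0 // mulr_ge0 // exprn_ge0 // ltW.
rewrite mulrDr -[X in X <= _]add0r lerD //.
  by rewrite mulr_ge0 ?sqr_ge0 // mulrn_wge0 // mulr_ge0 // exprn_ge0 // ltW.
rewrite mulr_sumr ler_sum // => i _; rewrite /bump /= !add1n.
rewrite -[X in normc X]mulr_natl normcM normc_nat normcM !normcX.
rewrite -[X in _ <= _ * X]mulr_natl [X in _ <= X]mulrCA.
rewrite ler_wpM2l ?ler0n // [X in _ <= X]mulrCA ler_pM ?exprn_ge0 ?normc_ge0 //.
  by rewrite lerXn2r ?nnegrE ?normc_ge0.
have E (x : R) : x ^+ i.+2 = x ^+ 2 * x ^+ i by rewrite -exprD add2n.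
rewrite !E expr_div_n -[X in _ <= X]mulrA ler_wpM2l ?exprn_ge0 ?normc_ge0 //.
rewrite mulrA mulVf ?mul1r; last by rewrite expf_neq0 // gt_eqF.
by rewrite lerXn2r ?nnegrE ?normc_ge0 // ltW.
Qed.

Lemma expn_deriv_le (b : R[i]) (q d : R) n : 0 <= q -> 0 < d ->
  normc b <= q -> normc (b ^+ n.-1 *+ n) <= (q + d) ^+ n / d.
Proof.
move=> q0 d0 bq; rewrite ler_pdivlMr //; case: n => [|n].
  by rewrite mulr0n normc0r mul0r expr0 ler01.
rewrite -mulr_natl normcM normc_nat normcX /= exprDn big_ord_recl [X in _ + X]big_ord_recl.
rewrite /= /bump /= bin1 expr1 subSS subn0 [X in _ <= X]addrCA -[X in X <= _]addr0 lerD //.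
  rewrite -mulrA -[X in _ <= X]mulr_natl ler_wpM2l ?ler0n // ler_wpM2r ?(ltW d0) //.
  by rewrite subn0 lerXn2r ?nnegrE ?normc_ge0.
rewrite addr_ge0 //.
  by rewrite mulrn_wge0 // mulr_ge0 // exprn_ge0 // ltW.
by apply: sumr_ge0 => i _; rewrite mulrn_wge0 // mulr_ge0 // exprn_ge0 // ltW.
Qed.

Lemma nearly_linear_pow n : nearly_linear (2 ^+ n) 1 (fun v : R[i] => (1 + v) ^+ n).
Proof.
move=> t /andP[t0 t1]; exists n%:R.
  by rewrite normc_nat -natrX ler_nat ltnW // ltn_expl.
move=> v vt; rewrite addr0 expr1n.
have := @expnD_taylor 1 v 1 1 n ler01 ltr01.
rewrite normc1r !expr1n divr1 => /(_ (lexx _) (le_trans vt t1)) /le_trans; apply.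
rewrite mulrC [1 + 1](_ : _ = 2) // ler_wpM2l ?exprn_ge0 //.
by rewrite lerXn2r ?nnegrE ?normc_ge0 // ltW.
Qed.

(** Trapezoidal rule around the quadrilateral with vertices 1, 1 + a, 1 + b and
    (1 + a)(1 + b), in the coordinate v = z - 1.  The rule is exact on constants,
    the linear term contributes only a b (b - a), and the remainders are of
    second order, so that everything is of third order.  This is the local form
    of Cauchy's theorem for the measure dz / z, for which dilations of the
    quadrilateral are harmless. *)
Lemma nearly_linear_square C d H (a b : R[i]) (t : R) : 0 <= C -> 0 < t <= 1 ->
  3 * t <= d -> normc a <= t -> normc b <= t -> nearly_linear C d H ->
  normc (a * (H 0 + H a - H b - H (a + b + a * b)) +
         b * (H a + H (a + b + a * b) - H 0 - H b)) <= 56 * C * t ^+ 3.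
Proof.
move=> C0 /andP[t0 t1] td at_ bt HL; set g := a + b + a * b.
have [|L LC HL'] := HL (3 * t); first by rewrite td mulr_gt0.
have gt : normc g <= 3 * t.
  apply: le_trans (normcD_le (normcD_le at_ bt) (normcM_le at_ bt)) _.
  have : t * t <= t by rewrite ler_piMr // ltW.
  lra.
have t3 : t <= 3 * t by lra.
have ra := HL' a (le_trans at_ t3); have rb := HL' b (le_trans bt t3).
have rg := HL' g gt.
set e := C * (3 * t) ^+ 2 in ra rb rg.
set Ra := (_ - L * a) in ra; set Rb := (_ - L * b) in rb; set Rg := (_ - L * g) in rg.
have -> : a * (H 0 + H a - H b - H g) + b * (H a + H g - H 0 - H b) =
   a * (Ra - Rb - Rg) + b * (Ra + Rg - Rb) + L * (a * b * (b - a)).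
  by rewrite /Ra /Rb /Rg /g; ring.
have e1 := normcM_le at_ (normcB_le (normcB_le ra rb) rg).
have e2 := normcM_le bt (normcB_le (normcD_le ra rg) rb).
have e3 := normcM_le LC (normcM_le (normcM_le at_ bt) (normcB_le bt at_)).
apply: le_trans (normcD_le (normcD_le e1 e2) e3) _.
by rewrite /e le_eqVlt; apply/orP; left; apply/eqP; ring.
Qed.

End NearlyLinear.

Section Update.
Context {R : rcfType} {s : nat}.
Implicit Types (x : 'rV[R[i]]_s).

Definition set_coord x (i : 'I_s) (v : R[i]) : 'rV[R[i]]_s :=
  \row_j (if j == i then v else x ord0 j).

Lemma set_coordE x i v j : set_coord x i v ord0 j = if j == i then v else x ord0 j.
Proof. by rewrite mxE. Qed.

Lemma set_coord_id x i : set_coord x i (x ord0 i) = x.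
Proof. by apply/rowP => j; rewrite set_coordE; case: eqP => [->|]. Qed.

End Update.

(** * Roots of unity and means over grids *)

Section RootsOfUnity.
Context {R : rcfType}.

Lemma normc_sqrE (z : R[i]) : normc z ^+ 2 = complex.Re z ^+ 2 + complex.Im z ^+ 2.
Proof. by case: z => a b; rewrite /normc sqr_sqrtr // addr_ge0 ?sqr_ge0. Qed.

(** Of the two square roots take the one in the right half-plane: then
    |u + 1|^2 >= 2 in w - 1 = (u - 1) (u + 1). *)
Lemma unit_sqrt (w : R[i]) : normc w = 1 ->
  exists u : R[i], [/\ u ^+ 2 = w, normc u = 1 & normc (u - 1) ^+ 2 <= normc (w - 1) ^+ 2 / 2].
Proof.
move=> w1.
have [u [uw u0]] : exists u : R[i], u ^+ 2 = w /\ 0 <= complex.Re u.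
  have [h|h] := lerP 0 (complex.Re (sqrtc w)).
    by exists (sqrtc w); rewrite sqr_sqrtc.
  by exists (- sqrtc w); rewrite sqrrN sqr_sqrtc raddfN /= oppr_ge0 ltW.
have u1 : normc u = 1.
  by apply/eqP; rewrite -(eqrXn2 (n := 2)) ?normc_ge0 // expr1n -normcX uw w1.
exists u; split => //.
have -> : w - 1 = (u - 1) * (u + 1) by rewrite -uw; ring.
rewrite normcM exprMn ler_pdivlMr // ler_wpM2l ?sqr_ge0 //.
have := normc_sqrE u; rewrite u1 expr1n normc_sqrE; case: u u0 {uw u1} => a b /=.
rewrite addr0; nra.
Qed.

(** Iterated square roots of -1; the order is not a smaller power of 2 because
    the power of exponent 2^k is -1. *)
Lemma prim_root_near_one k : exists w : R[i],
  [/\ (2 ^ k.+1).-primitive_root w, normc w = 1 & normc (w - 1) ^+ 2 <= 4 / 2 ^+ k].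
Proof.
suff [w [wN w1 wk]] : exists w : R[i],
    [/\ w ^+ (2 ^ k) = -1, normc w = 1 & normc (w - 1) ^+ 2 <= 4 / 2 ^+ k].
  exists w; split => //.
  have w2 : w ^+ (2 ^ k.+1) = 1 by rewrite expnS mulnC exprM wN sqrrN expr1n.
  have [m pm md] := prim_order_exists (expn_gt0 2 k.+1) w2.
  have [j jk em] := dvdn_pfactor m k.+1 (isT : prime 2) md.
  move: jk; rewrite leq_eqVlt => /orP[/eqP jk|jk]; first by rewrite -jk -em.
  have : w ^+ (2 ^ k) == 1.
    by rewrite -(prim_order_dvd pm) em dvdn_exp2l.
  rewrite wN -subr_eq0 -opprD oppr_eq0 -[1 + 1]/(2%:R) pnatr_eq0.
  by [].
elim: k => [|k [w [wN w1 wk]]].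
  exists (-1); split; rewrite ?normcN ?normc1r ?expr1 //.
  by rewrite -opprD normcN -[1 + 1]/(2%:R) normc_nat expr0; lra.
have [u [uw u1 uk]] := unit_sqrt w1.
exists u; split => //; first by rewrite expnS exprM uw.
apply: le_trans uk _; rewrite [2 ^+ k.+1]exprS invfM mulrCA [X in _ <= X]mulrC.
by rewrite ler_wpM2r // invr_ge0.
Qed.

Lemma prim_root_sum N (w : R[i]) m : N.-primitive_root w ->
  \sum_(a < N) (w ^+ a) ^+ m = if (N %| m)%N then N%:R else 0.
Proof.
move=> pw; have [Nm|Nm] := boolP (N %| m)%N.
  rewrite (eq_bigr (fun=> 1)) ?sumr_const ?card_ord // => a _.
  by rewrite exprAC (eqP (_ : w ^+ m == 1)) ?expr1n // -(prim_order_dvd pw).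
have wm : w ^+ m - 1 != 0 by rewrite subr_eq0 -(prim_order_dvd pw).
apply: (mulfI wm); rewrite mulr0.
under eq_bigr do rewrite exprAC.
by rewrite -subrX1 exprAC (prim_expr_order pw) expr1n subrr.
Qed.

End RootsOfUnity.

Section Grid.
Context {R : rcfType} {s N : nat}.
Implicit Types (G : 'rV[R[i]]_s -> R[i]) (j : {ffun 'I_s -> 'I_N.+1}) (w : R[i]) (y : 'I_s -> R).

Definition grid_mean (h : {ffun 'I_s -> 'I_N.+1} -> R[i]) : R[i] :=
  (N.+1%:R^-1) ^+ s * \sum_j h j.

Definition torus_pt w y j : 'rV[R[i]]_s := \row_i ((y i)%:C * w ^+ j i).

Lemma grid_meanB h h' : grid_mean h - grid_mean h' = grid_mean (fun j => h j - h' j).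
Proof. by rewrite /grid_mean -mulrBr -sumrB. Qed.

Lemma grid_mean_le h (B : R) : (forall j, normc (h j) <= B) -> normc (grid_mean h) <= B.
Proof.
move=> hB; rewrite normcM normcX normcV normc_nat exprVn.
rewrite mulrC ler_pdivrMr ?exprn_gt0 //.
apply: le_trans (normc_sum _ _ _) _.
apply: le_trans (ler_sum _ (fun j _ => hB j)) _.
by rewrite sumr_const card_ffun !card_ord -[X in X <= _]mulr_natr natrX.
Qed.

Definition turn i j : {ffun 'I_s -> 'I_N.+1} :=
  [ffun l => if l == i then ordS (j l) else j l].

Lemma turn_inj i : injective (turn i).
Proof.
move=> j j' /ffunP e; apply/ffunP => l; have := e l; rewrite !ffunE.
by case: ifP => // _ /(can_inj (@ordSK _)).
Qed.

Lemma sum_turn i (h : {ffun 'I_s -> 'I_N.+1} -> R[i]) : \sum_j h (turn i j) = \sum_j h j.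
Proof. by rewrite [RHS](reindex_inj (@turn_inj i)). Qed.

Lemma torus_pt_turn w y i j : w ^+ N.+1 = 1 ->
  torus_pt w y (turn i j) = set_coord (torus_pt w y j) i (torus_pt w y j ord0 i * w).
Proof.
move=> wN; apply/rowP => l; rewrite set_coordE !mxE ffunE; case: eqP => // ->.
by rewrite -mulrA -exprSr /= expr_mod.
Qed.

Definition set_radius y (i : 'I_s) (t : R) := fun l => if l == i then t else y l.

Lemma torus_pt_set_radius w y i t j :
  torus_pt w (set_radius y i t) j = set_coord (torus_pt w y j) i (t%:C * w ^+ j i).
Proof. by apply/rowP => l; rewrite set_coordE !mxE /set_radius; case: eqP => // ->. Qed.

Lemma set_coord_twice (x : 'rV[R[i]]_s) i u v : set_coord (set_coord x i u) i v = set_coord x i v.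
Proof. by apply/rowP => l; rewrite !set_coordE; case: eqP. Qed.

(** Sum the quadrilateral estimate over the grid.  Turning by [w] permutes the
    grid, so the two radial sides of neighbouring quadrilaterals cancel, and
    what remains is (w - 1) times twice the difference of the two means. *)
Lemma grid_mean_shift_step G w y i (r C d : R) : w ^+ N.+1 = 1 -> w != 1 -> 0 <= C ->
  normc (w - 1) <= 1 -> 3 * normc (w - 1) <= d -> `|r - 1| <= normc (w - 1) ->
  (forall j, nearly_linear C d (fun v => G (set_coord (torus_pt w y j) i (torus_pt w y j ord0 i * (1 + v))))) ->
  normc (grid_mean (G \o torus_pt w y) - grid_mean (G \o torus_pt w (set_radius y i (y i * r)))) <=
    28 * C * normc (w - 1) ^+ 2.
Proof.
move=> wN w1 C0 t1 td rt HL; set t := normc (w - 1) in t1 td rt *.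
have t0 : 0 < t by rewrite lt_def normc_ge0 andbT normc_eq0 subr_eq0.
pose a := w - 1; pose b := (r - 1)%:C.
have bt : normc b <= t by rewrite normc_real.
pose y' := set_radius y i (y i * r).
have key j : normc (a * (G (torus_pt w y j) + G (torus_pt w y (turn i j)) - G (torus_pt w y' j) - G (torus_pt w y' (turn i j)))
    + b * (G (torus_pt w y (turn i j)) + G (torus_pt w y' (turn i j)) - G (torus_pt w y j) - G (torus_pt w y' j)))
    <= 56 * C * t ^+ 3.
  have := nearly_linear_square C0 (_ : 0 < t <= 1) td (lexx _ : normc a <= t) bt (HL j).
  rewrite t0 t1 => /(_ isT).
  rewrite addr0 mulr1 set_coord_id [1 + a]addrC subrK -torus_pt_turn //.
  have -> : 1 + b = r%:C by rewrite /b rmorphB rmorph1 addrC subrK.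
  have -> : set_coord (torus_pt w y j) i (torus_pt w y j ord0 i * r%:C) = torus_pt w y' j.
    by rewrite torus_pt_set_radius mxE rmorphM /= mulrAC.
  have -> : 1 + (a + b + a * b) = r%:C * w by rewrite /a /b rmorphB rmorph1; ring.
  have -> // : set_coord (torus_pt w y j) i (torus_pt w y j ord0 i * (r%:C * w)) = torus_pt w y' (turn i j).
  rewrite torus_pt_turn // torus_pt_set_radius set_coord_twice; congr set_coord.
  by rewrite set_coordE eqxx mxE rmorphM /=; ring.
have := grid_mean_le key; rewrite /grid_mean.
rewrite big_split /= -!mulr_sumr !(sumrB, big_split) /=.
rewrite -!/(grid_mean _).
rewrite (sum_turn i (fun j => G (torus_pt w y j))) (sum_turn i (fun j => G (torus_pt w y' j))).
set S := \sum_j _; set S' := \sum_j _.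
have -> : a * (S + S - S' - S') + b * (S + S' - S - S') = 2%:R * a * (S - S') by ring.
rewrite mulrCA normcM [normc (2%:R * a)]normcM normc_nat -/t -mulrBr.
have -> : 56 * C * t ^+ 3 = 2%:R * t * (28 * C * t ^+ 2) by ring.
by rewrite ler_pM2l // mulr_gt0.
Qed.

End Grid.

(** * Contour shift on grids, Joukowski map and Fejer kernel *)

Section GridShift.
Context {R : rcfType} {s N : nat}.
Implicit Types (G : 'rV[R[i]]_s -> R[i]) (j : {ffun 'I_s -> 'I_N.+1}) (w : R[i]) (y : 'I_s -> R).

Lemma eq_grid_mean G w y y' : y =1 y' ->
  grid_mean (N := N) (G \o torus_pt w y) = grid_mean (N := N) (G \o torus_pt w y').
Proof.
move=> e; congr (_ * _); apply: eq_bigr => j _ /=; congr G.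
by apply/rowP => l; rewrite !mxE e.
Qed.

Lemma grid_mean_shift_ray G w y i (r C d : R) L : w ^+ N.+1 = 1 -> w != 1 -> 0 <= C ->
  normc (w - 1) <= 1 -> 3 * normc (w - 1) <= d -> `|r - 1| <= normc (w - 1) ->
  (forall l, (l < L)%N -> let y' := set_radius y i (y i * r ^+ l) in
     forall j, nearly_linear C d (fun v => G (set_coord (torus_pt w y' j) i (torus_pt w y' j ord0 i * (1 + v))))) ->
  normc (grid_mean (N := N) (G \o torus_pt w y) - grid_mean (N := N) (G \o torus_pt w (set_radius y i (y i * r ^+ L)))) <=
    L%:R * (28 * C * normc (w - 1) ^+ 2).
Proof.
move=> wN w1 C0 t1 td rt HL.
have id0 : y =1 set_radius y i (y i * r ^+ 0).
  by move=> l; rewrite /set_radius expr0 mulr1; case: eqP => // ->.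
rewrite (eq_grid_mean G w id0).
elim: L HL => [|L IH] HL; first by rewrite subrr normc0r mul0r.
set g := grid_mean (N := N) (G \o torus_pt w (set_radius y i (y i * r ^+ L))).
have -> (u v : R[i]) : u - v = (u - g) + (g - v) by ring.
rewrite -natr1 mulrDl mul1r; apply: normcD_le.
  by apply: IH => l lL; apply: HL; rewrite ltnW.
have e : set_radius y i (y i * r ^+ L.+1) =1
    set_radius (set_radius y i (y i * r ^+ L)) i ((set_radius y i (y i * r ^+ L)) i * r).
  by move=> l; rewrite /set_radius; case: eqP => // _; rewrite eqxx exprSr mulrA.
rewrite (eq_grid_mean G w e).
apply: grid_mean_shift_step td rt _ => //.
exact: HL.
Qed.

(** The radii are changed one coordinate at a time; all intermediate tori have
    radii between [t] and 1. *)
Lemma grid_mean_shift G w (t r : 'I_s -> R) (C d : R) L : w ^+ N.+1 = 1 -> w != 1 -> 0 <= C ->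
  normc (w - 1) <= 1 -> 3 * normc (w - 1) <= d ->
  (forall i, [/\ 0 < r i, r i <= 1, r i ^+ L = t i & `|r i - 1| <= normc (w - 1)]) ->
  (forall y, (forall i, t i <= y i <= 1) -> forall i j,
     nearly_linear C d (fun v => G (set_coord (torus_pt w y j) i (torus_pt w y j ord0 i * (1 + v))))) ->
  normc (grid_mean (N := N) (G \o torus_pt w (fun=> 1)) - grid_mean (N := N) (G \o torus_pt w t)) <=
    s%:R * (L%:R * (28 * C * normc (w - 1) ^+ 2)).
Proof.
move=> wN w1 C0 t1 td rP HL.
pose Y m : 'I_s -> R := fun i => if (i < m)%N then t i else 1.
have tl i l : (l <= L)%N -> t i <= r i ^+ l <= 1.
  move=> lL; have [r0 r1 <- _] := rP i.
  by rewrite exprn_ile1 ?(ltW r0) // andbT ler_wiXn2l ?(ltW r0).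
have tt i : t i <= 1 by have := tl i 0%N isT; rewrite expr0 => /andP[].
suff H m : (m <= s)%N -> normc (grid_mean (N := N) (G \o torus_pt w (Y 0%N)) - grid_mean (N := N) (G \o torus_pt w (Y m))) <=
    m%:R * (L%:R * (28 * C * normc (w - 1) ^+ 2)).
  have := H s (leqnn s).
  by rewrite (@eq_grid_mean G w (Y s) t) // => i; rewrite /Y ltn_ord.
elim: m => [_|m IH ms]; first by rewrite subrr normc0r mul0r.
set g := grid_mean (N := N) (G \o torus_pt w (Y m)).
have -> (u v : R[i]) : u - v = (u - g) + (g - v) by ring.
rewrite -natr1 mulrDl mul1r; apply: normcD_le; first by apply: IH; rewrite ltnW.
pose i := Ordinal ms.
have [r0 r1 rL rt] := rP i.
have e : Y m.+1 =1 set_radius (Y m) i (Y m i * r i ^+ L).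
  move=> l; rewrite /set_radius /Y rL /= ltnn mul1r ltnS leq_eqVlt -val_eqE /=.
  by case: eqP => //= e; congr t; apply: val_inj.
rewrite (eq_grid_mean G w e).
apply: (grid_mean_shift_ray (d := d)) => // l lL y' j; apply: HL => l'.
rewrite /y' /set_radius /Y /= ltnn mul1r; case: eqP => [->|_]; first exact: tl (ltnW lL).
by case: ifP => _; rewrite ?tt lexx.
Qed.

End GridShift.

Section Joukowski.
Context {R : rcfType}.
Implicit Types (z : R[i]).

Definition joukowski z : R[i] := (z + z^-1) / 2%:R.
Definition joukowskiv {s} (z : 'rV[R[i]]_s) : 'rV[R[i]]_s := \row_i joukowski (z ord0 i).
Definition cheb_val m z : R[i] := (z ^+ m + z ^- m) / 2%:R.

Lemma two_neq0 : 2%:R != 0 :> R[i].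
Proof. by rewrite pnatr_eq0. Qed.

Lemma normc_half : normc (2%:R^-1 : R[i]) = 2^-1.
Proof. by rewrite normcV normc_nat. Qed.

Lemma joukowskiV z : joukowski z^-1 = joukowski z.
Proof. by rewrite /joukowski invrK addrC. Qed.

Lemma unit_neq0 z : normc z = 1 -> z != 0.
Proof. by move=> z1; rewrite -normc_eq0 z1 oner_neq0. Qed.

Lemma cheb_val_le1 m z : normc z = 1 -> normc (cheb_val m z) <= 1.
Proof.
move=> z1; rewrite /cheb_val normcM normc_half ler_pdivrMr // mul1r.
by apply: le_trans (ler_normcD _ _) _; rewrite normcV normcX z1 expr1n invr1.
Qed.

(** The cube inherits its metric from the torus up to a contraction. *)
Lemma joukowski_dist z z' : normc z = 1 -> normc z' = 1 ->
  normc (joukowski z - joukowski z') <= normc (z - z').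
Proof.
move=> z1 z1'; have z0 := unit_neq0 z1; have z0' := unit_neq0 z1'.
have -> : joukowski z - joukowski z' = (z - z') * (1 - z^-1 * z'^-1) * 2%:R^-1.
  by rewrite /joukowski; field; rewrite z0 z0'.
rewrite normcM normc_half normcM ler_pdivrMr // ler_wpM2l ?normc_ge0 //.
apply: le_trans (ler_normcB _ _) _.
by rewrite normc1r normcM !normcV z1 z1' invr1 mulr1.
Qed.

(** [F \o joukowskiv] does not change when coordinates are inverted, and the
    grid is stable under inversion, so each of the 2^s terms of the product of
    the (z^k + z^-k)/2 contributes the same amount.  Only then can the torus be
    shrunk: z^k is small inside the disc and z^-k is not. *)
Lemma grid_mean_cheb_val (s N : nat) (F : 'rV[R[i]]_s -> R[i]) w (k : 'I_s -> nat) :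
  w ^+ N.+1 = 1 ->
  grid_mean (N := N) (fun j => F (joukowskiv (torus_pt w (fun=> 1) j)) * \prod_i cheb_val (k i) (w ^+ j i)) =
  grid_mean (N := N) (fun j => F (joukowskiv (torus_pt w (fun=> 1) j)) * \prod_i (w ^+ j i) ^+ k i).
Proof.
move=> wN; congr (_ * _).
have w0 : w != 0.
  by apply/eqP => w0; move: wN; rewrite w0 expr0n => /eqP; rewrite eq_sym oner_eq0.
pose fl (sg : {ffun 'I_s -> bool}) (j : {ffun 'I_s -> 'I_N.+1}) : {ffun 'I_s -> 'I_N.+1} :=
  [ffun i => if sg i then j i else (- j i)%R].
have flK sg : involutive (fl sg).
  by move=> j; apply/ffunP => i; rewrite !ffunE; case: (sg i) => //; rewrite opprK.
have wopp (a : 'I_N.+1) : w ^+ (- a)%R = w ^- a.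
  apply: (mulIf (expf_neq0 a w0)); rewrite mulVf ?expf_neq0 // /=.
  by rewrite expr_mod // -exprD subnK ?wN // ltnW.
pose term sg j := F (joukowskiv (torus_pt w (fun=> 1) j)) *
   \prod_i (2%:R^-1 * (w ^+ fl sg j i) ^+ k i).
transitivity (\sum_j \sum_sg term sg j).
  apply: eq_bigr => j _; rewrite -mulr_sumr; congr (_ * _).
  rewrite (eq_bigr (fun i => \sum_(b : bool) 2%:R^-1 * (w ^+ (if b then j i else (- j i)%R)) ^+ k i)).
    rewrite bigA_distr_bigA; apply: eq_bigr => sg _; apply: eq_bigr => i _.
    by rewrite ffunE.
  by move=> i _; rewrite big_bool /cheb_val /= wopp exprVn; ring.
rewrite exchange_big /=.
have E sg : \sum_j term sg j = \sum_(j : {ffun 'I_s -> 'I_N.+1})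
    F (joukowskiv (torus_pt w (fun=> 1) j)) * \prod_i (2%:R^-1 * (w ^+ j i) ^+ k i).
  rewrite [RHS](reindex_inj (inv_inj (flK sg))).
  apply: eq_bigr => j _; congr (F _ * _); apply/rowP => i; rewrite !mxE ffunE.
  by rewrite !mul1r; case: ifP => // _; rewrite wopp joukowskiV.
rewrite (eq_bigr _ (fun sg _ => E sg)).
rewrite sumr_const card_ffun card_bool card_ord -[LHS]mulr_natl mulr_sumr.
apply: eq_bigr => j _; rewrite big_split /= prodr_const card_ord mulrCA; congr (_ * _).
by rewrite mulrA natrX -exprMn mulfV ?expr1n ?mul1r ?two_neq0.
Qed.

End Joukowski.

Section Kernel.
Context {R : rcfType} (K : nat).
Implicit Types (z u : R[i]).

Definition fejer u : R := normc (\sum_(l < K.+1) u ^+ l) ^+ 2 / K.+1%:R.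
(** The symmetrisation in [z'] makes the kernel a function of the two Joukowski
    images, hence a combination of products of Chebyshev polynomials. *)
Definition fejer_kernel z z' : R := (fejer (z * z') + fejer (z * z'^-1)) / 2.
(** The distance between two natural numbers, as a frequency of the double sum
    that expands the square in [fejer]. *)
Definition gap (p : 'I_K.+1 * 'I_K.+1) : nat := ((p.1 - p.2) + (p.2 - p.1))%N.

Lemma fejer_ge0 u : 0 <= fejer u.
Proof. by rewrite /fejer divr_ge0 ?sqr_ge0. Qed.

Lemma fejer_kernel_ge0 z z' : 0 <= fejer_kernel z z'.
Proof. by rewrite divr_ge0 // addr_ge0 ?fejer_ge0. Qed.

(** The geometric sum times u - 1 is u^(K+1) - 1, which stays bounded. *)
Lemma fejer_concentration u : normc u = 1 -> fejer u * normc (u - 1) ^+ 2 <= 4 / K.+1%:R.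
Proof.
move=> u1; rewrite /fejer mulrAC -exprMn -normcM mulrC mulrC ler_wpM2r ?invr_ge0 //.
rewrite [X in normc X]mulrC -subrX1.
have : normc (u ^+ K.+1 - 1) <= 2.
  by apply: le_trans (ler_normcB _ _) _; rewrite normcX u1 expr1n normc1r; lra.
have := normc_ge0 (u ^+ K.+1 - 1); nra.
Qed.

(** Since J is invariant under inversion, the distance of the images is at most
    the distance from [z] to each of [z'] and [z'^-1], and each half of the
    kernel is compared with its own one. *)
Lemma fejer_kernel_concentration z z' : normc z = 1 -> normc z' = 1 ->
  fejer_kernel z z' * normc (joukowski z - joukowski z') ^+ 2 <= 4 / K.+1%:R.
Proof.
move=> z1 z1'; have z0 := unit_neq0 z1; have z0' := unit_neq0 z1'.
have zV' : normc z'^-1 = 1 by rewrite normcV z1' invr1.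
have aux v : normc v = 1 -> joukowski v = joukowski z' ->
    fejer (z * v^-1) * normc (joukowski z - joukowski z') ^+ 2 <= 4 / K.+1%:R.
  move=> v1 <-; have u1 : normc (z * v^-1) = 1 by rewrite normcM normcV z1 v1 invr1 mulr1.
  apply: le_trans (fejer_concentration u1); rewrite ler_wpM2l ?fejer_ge0 //.
  rewrite lerXn2r ?nnegrE ?normc_ge0 //; apply: le_trans (joukowski_dist z1 v1) _.
  have -> : z - v = (z * v^-1 - 1) * v by field; exact: unit_neq0.
  by rewrite normcM v1 mulr1.
have := aux _ z1' erefl; have := aux _ zV' (joukowskiV z'); rewrite invrK /fejer_kernel.
move: (normc _ ^+ 2) (fejer (z * z')) (fejer _) (4 / _) => n a b c h1 h2.
by rewrite mulrAC ler_pdivrMr // mulrDl mulr_natr mulr2n lerD.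
Qed.

Lemma normc_sqr_unit u : normc u = 1 ->
  (normc (\sum_(l < K.+1) u ^+ l) ^+ 2)%:C =
  (\sum_(l < K.+1) u ^+ l) * (\sum_(l < K.+1) u ^- l).
Proof.
move=> u1; rewrite rmorphXn /= -normc_norm sqr_normc rmorph_sum /=; congr (_ * _).
apply: eq_bigr => l _; rewrite rmorphXn /= -exprVn; congr (_ ^+ _).
apply: (mulfI (unit_neq0 u1)); rewrite mulfV ?unit_neq0 //.
by rewrite -sqr_normc normc_norm u1 rmorph1 expr1n.
Qed.

Lemma laurent_sym z (l m : nat) : z != 0 ->
  z ^+ l / z ^+ m + z ^+ m / z ^+ l =
  z ^+ ((l - m) + (m - l)) + z ^- ((l - m) + (m - l)).
Proof.
move=> z0; wlog ml : l m / (m <= l)%N => [H|].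
  have [ml|/ltnW ml] := leqP m l; first exact: H.
  by rewrite addrC H // [((m - l) + _)%N]addnC.
have -> : (m - l = 0)%N by apply/eqP; rewrite subn_eq0.
rewrite addn0; move: (subnK ml); move: (l - m)%N => d <-; rewrite exprD; field.
by rewrite !expf_neq0.
Qed.

Lemma fejer_cheb_val u : normc u = 1 ->
  (fejer u)%:C = K.+1%:R^-1 * \sum_p cheb_val (gap p) u.
Proof.
move=> u1; have u0 := unit_neq0 u1.
rewrite /fejer rmorphM fmorphV rmorph_nat /= mulrC; congr (_ * _).
rewrite normc_sqr_unit //.
pose f (l m : 'I_K.+1) := u ^+ l / u ^+ m.
have e : \sum_l \sum_m f l m = \sum_l \sum_m (f l m + f m l) / 2%:R.
  under [RHS]eq_bigr do rewrite -mulr_suml big_split /=.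
  rewrite -mulr_suml big_split /= [X in _ + X]exchange_big /=.
  by field.
transitivity (\sum_l \sum_m f l m).
  by rewrite mulr_suml; apply: eq_bigr => l _; rewrite mulr_sumr.
rewrite e pair_bigA /=; apply: eq_bigr => -[l m] _.
by rewrite /f laurent_sym.
Qed.

Lemma cheb_valM g z z' : z != 0 -> z' != 0 ->
  (cheb_val g (z * z') + cheb_val g (z * z'^-1)) / 2%:R = cheb_val g z * cheb_val g z'.
Proof.
move=> z0 z0'; rewrite /cheb_val !exprMn !exprVn; field.
by rewrite !expf_neq0.
Qed.

Lemma fejer_kernelE z z' : normc z = 1 -> normc z' = 1 ->
  (fejer_kernel z z')%:C = K.+1%:R^-1 * \sum_p cheb_val (gap p) z * cheb_val (gap p) z'.
Proof.
move=> z1 z1'; rewrite /fejer_kernel rmorphM fmorphV rmorph_nat rmorphD /=.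
rewrite !fejer_cheb_val; try by rewrite normcM ?normcV z1 z1' ?invr1 mulr1.
rewrite -mulrDr -mulrA; congr (_ * _); rewrite -big_split mulr_suml /=.
by apply: eq_bigr => p _; rewrite cheb_valM ?unit_neq0.
Qed.

Lemma cheb_val0 z : cheb_val 0 z = 1.
Proof. by rewrite /cheb_val !expr0 invr1 -mulr2n mulfV ?two_neq0. Qed.

Lemma cheb_val_sum N (w : R[i]) m : (N.+1).-primitive_root w -> (m <= N)%N ->
  \sum_(a < N.+1) cheb_val m (w ^+ a) = if m == 0%N then N.+1%:R else 0.
Proof.
move=> pw mN; case: eqP => [->|/eqP m0].
  rewrite (eq_bigr (fun=> 1)) ?sumr_const ?card_ord // => a _; exact: cheb_val0.
have Nm : (N.+1 %| m)%N = false by rewrite gtnNdvd // lt0n.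
rewrite /cheb_val -mulr_suml big_split /= (prim_root_sum m pw) Nm add0r.
have wm : w ^+ m != 1 by rewrite -(prim_order_dvd pw) Nm.
suff -> : \sum_(a < N.+1) (w ^+ a) ^- m = 0 by rewrite mul0r.
have vm : w ^- m - 1 != 0.
  by rewrite subr_eq0; apply: contra wm => /eqP e; rewrite -[w ^+ m]invrK e invr1.
apply: (mulfI vm); rewrite mulr0.
rewrite (eq_bigr (fun a : 'I_N.+1 => (w ^- m) ^+ a)); last by move=> a _; rewrite exprVn exprAC.
by rewrite -subrX1 exprVn exprAC (prim_expr_order pw) expr1n invr1 subrr.
Qed.

(** Frequencies at most K are not aliased on a grid of more than K points, so
    only the diagonal terms of the double sum survive. *)
Lemma fejer_kernel_mean N (w : R[i]) z : (N.+1).-primitive_root w -> (K <= N)%N ->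
  normc w = 1 -> normc z = 1 ->
  N.+1%:R^-1 * \sum_(a < N.+1) fejer_kernel z (w ^+ a) = 1.
Proof.
move=> pw KN w1 z1; apply: (@complexI R); rewrite rmorphM rmorph_sum fmorphV rmorph_nat /=.
have wa1 a : normc (w ^+ a) = 1 by rewrite normcX w1 expr1n.
under eq_bigr do rewrite fejer_kernelE //.
rewrite -mulr_sumr exchange_big /=.
have gN p : (gap p <= N)%N.
  apply: leq_trans KN; rewrite /gap; case: p => -[l lK] [m mK] /=.
  have [h|/ltnW h] := leqP l m.
    by rewrite (eqP (_ : l - m == 0)%N) ?subn_eq0 // add0n (leq_trans (leq_subr _ _)).
  by rewrite (eqP (_ : m - l == 0)%N) ?subn_eq0 // addn0 (leq_trans (leq_subr _ _)).
rewrite (eq_bigr (fun p => if p.1 == p.2 then N.+1%:R else 0)); last first.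
  move=> p _; rewrite -mulr_sumr (cheb_val_sum pw) //.
  have -> : (gap p == 0)%N = (p.1 == p.2).
    by rewrite /gap addn_eq0 !subn_eq0 -eqn_leq.
  case: eqP => [e|_]; last by rewrite mulr0.
  by rewrite (_ : gap p = 0%N) ?cheb_val0 ?mul1r // /gap e subnn.
rewrite -(pair_bigA _ (fun l m : 'I_K.+1 => if l == m then N.+1%:R else 0)) /=.
rewrite (eq_bigr (fun=> N.+1%:R)); last by move=> l _; rewrite -big_mkcond (big_pred1 l) // => m; rewrite /= eq_sym.
rewrite sumr_const card_ord -[X in _ * (_ * X)]mulr_natl.
by rewrite mulKf ?mulVf ?rmorph1 // pnatr_eq0.
Qed.

End Kernel.

(** * Second-order estimates from a local power series *)

Lemma geometric_sum_le (R : realFieldType) (mu : R) K : 0 <= mu < 1 ->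
  \sum_(l < K) mu ^+ l <= (1 - mu)^-1.
Proof.
move=> /andP[m0 m1]; have d0 : 0 < 1 - mu by rewrite subr_gt0.
suff -> : \sum_(l < K) mu ^+ l = (1 - mu ^+ K) / (1 - mu).
  by rewrite ler_piMl ?invr_ge0 ?(ltW d0) // gerBl exprn_ge0.
elim: K => [|K IH]; first by rewrite big_ord0 expr0 subrr mul0r.
by rewrite big_ord_recr /= IH exprS; field; rewrite gt_eqF.
Qed.

(** The sum over a box factors into one-dimensional geometric sums. *)
Lemma geometric_box_sum_le (R : realFieldType) (mu : R) s K : 0 <= mu < 1 ->
  \sum_(k : {ffun 'I_s -> 'I_K}) \prod_i mu ^+ k i <= (1 - mu)^-1 ^+ s.
Proof.
move=> m01; have [m0 _] := andP m01.
rewrite -(bigA_distr_bigA (fun _ (j : 'I_K) => mu ^+ j)) prodr_const card_ord.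
rewrite lerXn2r ?nnegrE ?geometric_sum_le //.
  by apply: sumr_ge0 => i _; rewrite exprn_ge0.
by apply: le_trans (geometric_sum_le 0 m01); rewrite big_ord0.
Qed.

Lemma geometric_fset_sum_le (R : realFieldType) (mu : R) s (J : {fset multinom s}) :
  0 <= mu < 1 ->
  \sum_(k : J) mu ^+ mdeg (val k) <= (1 - mu)^-1 ^+ s.
Proof.
move=> m01; have [m0 _] := andP m01.
pose K := (\max_(k : J) mdeg (val k))%N.
pose phi (k : J) : {ffun 'I_s -> 'I_K.+1} := [ffun i => inord (val k i)].
have phiE k i : phi k i = val k i :> nat.
  rewrite ffunE inordK // ltnS; apply: leq_trans (leq_bigmax k).
  by rewrite mdegE (bigD1 i) //= leq_addr.
have phi_inj : injective phi.
  move=> k k' e; apply: val_inj; apply/mnmP => i.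
  by rewrite -!phiE e.
apply: le_trans (geometric_box_sum_le s K.+1 m01).
rewrite (eq_bigl (fun k => k \in (finset.setT : {set J}))); last by move=> k; rewrite finset.in_setT.
rewrite (eq_bigr (fun k => \prod_i mu ^+ phi k i)); last first.
  by move=> k _; rewrite prodrXr mdegE; congr (_ ^+ _); apply: eq_bigr => i _; rewrite phiE.
rewrite -(big_imset (h := phi) (A := finset.setT) (fun f => \prod_i mu ^+ f i)) /=; last first.
  by move=> ? ? _ _; exact: phi_inj.
rewrite [X in _ <= X](bigID (mem (phi @: finset.setT))) /= lerDl.
by apply: sumr_ge0 => f _; apply: prodr_ge0 => i _; rewrite exprn_ge0.
Qed.

Section LocalAnalytic.
Context {R : realType} {s : nat}.
Implicit Types (x a b : 'rV[R[i]]_s) (F : 'rV[R[i]]_s -> R[i]).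

Lemma partial_sumE (c : multinom s -> R[i]) (J : {fset multinom s}) :
  partial_sum c J = \sum_(k <- J) c k.
Proof. by rewrite big_seq_fsetE. Qed.

(** Adding one index to a large enough finite set changes the partial sum by a
    bounded amount. *)
Lemma unconditional_term_bounded (c : multinom s -> R[i]) (l : R[i]) :
  partial_sum (c : multinom s -> R[i]^o) J @[J --> totally] --> (l : R[i]^o) ->
  exists2 B, 0 <= B & forall k, normc (c k) <= B.
Proof.
have FF : Filter (@totally (multinom s)) by exact: totally_filter.
move=> /cvgrPdist_lt cl; have [J0 _ hJ] := cl _ (@ltr01 R[i]).
have S0 : 0 <= \sum_(k <- J0) normc (c k).
  by apply: sumr_ge0 => k _; exact: normc_ge0.
exists (2 + \sum_(k <- J0) normc (c k)); first by rewrite addr_ge0.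
move=> k; have [kJ|kJ] := boolP (k \in J0).
  rewrite (big_fsetD1 k kJ) /= addrCA lerDl addr_ge0 //.
  by apply: sumr_ge0 => ? _; exact: normc_ge0.
rewrite -[X in X <= _]addr0 lerD //.
have hlt J : (J0 `<=` J)%fset -> normc (l - partial_sum c J) < 1.
  by move=> JJ; have := hJ J JJ; rewrite /= normc_norm -(rmorph1 (real_complex R)) ltcR.
have -> : c k = (l - partial_sum c J0) - (l - partial_sum c (k |` J0)%fset).
  by rewrite !partial_sumE big_fsetU1 //=; ring.
apply: le_trans (normcB_le (ltW (hlt J0 _)) (ltW (hlt (k |` J0)%fset _))) _ => //.
exact: fsubsetU1.
Qed.

Lemma partial_sums_close (I : finType) (c : I -> multinom s -> R[i]) (l : I -> R[i]) (e : R) :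
  0 < e ->
  (forall t, partial_sum (c t : multinom s -> R[i]^o) J @[J --> totally] --> (l t : R[i]^o)) ->
  exists J : {fset multinom s}, forall t, normc (l t - partial_sum (c t) J) <= e.
Proof.
move=> e0 cl; have FF : Filter (@totally (multinom s)) by exact: totally_filter.
have : \forall J \near totally, forall t, normc (l t - partial_sum (c t) J) <= e.
  apply: filter_forall => t; have /cvgrPdist_lt h := cl t.
  have {h} := h e%:C; rewrite ltcR => /(_ e0); apply: filterS => J /=.
  by rewrite normc_norm ltcR => /ltW.
by move=> [J _ /(_ J (fsubset_refl _)) h]; exists J.
Qed.

Lemma monomial_set_coord a x i v k :
  monomial (set_coord x i v - a) k =
  (v - a ord0 i) ^+ k i * \prod_(j < s | j != i) (x ord0 j - a ord0 j) ^+ k j.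
Proof.
rewrite /monomial (bigD1 i) //= !mxE eqxx; congr (_ * _).
by apply: eq_bigr => j /negbTE ji; rewrite !mxE ji.
Qed.

Lemma prod_normc_le a x i (q : R) (k : multinom s) :
  (forall j, normc (x ord0 j - a ord0 j) <= q) ->
  normc (\prod_(j < s | j != i) (x ord0 j - a ord0 j) ^+ k j) <= q ^+ (mdeg k - k i).
Proof.
move=> xq; have -> : (mdeg k - k i = \sum_(j < s | j != i) k j)%N.
  by rewrite mdegE (bigD1 i) //= addKn.
rewrite normc_prod -prodrXr.
apply: ler_prod => j _; rewrite normc_ge0 normcX lerXn2r ?nnegrE ?normc_ge0 //.
exact: le_trans (normc_ge0 _) (xq i).
Qed.

(** Partial sums satisfy first-order expansions with constants that do not
    depend on the finite set of indices.  To pass to the limit the slope is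
    eliminated between two increments w and w', and the difference quotient at
    increment [t] then serves as the slope at scale [t]. *)
Lemma analytic_at_local F a : analytic_at F a ->
  exists (r C : R), [/\ 0 < r, 1 <= C & forall x,
    (forall j, normc (x ord0 j - a ord0 j) <= r) ->
    normc (F x) <= C /\ forall i, nearly_linear C r (fun w => F (set_coord x i (x ord0 i + w)))].
Proof.
move=> [r [c [r0 hF]]].
have r8 : 0 < r / 8 by rewrite divr_gt0.
have [B B0 hB] : exists2 B, 0 <= B & forall k, normc (c k) * (r / 2) ^+ mdeg k <= B.
  pose z := (a + const_mx (r / 2)%:C).
  have zE j : z ord0 j - a ord0 j = (r / 2)%:C by rewrite !mxE addrC addKr.
  have /unconditional_term_bounded[B B0 hB] : partial_sum (fun k => c k * monomial (z - a) k : R[i]^o) J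
      @[J --> totally] --> (F z : R[i]^o).
    by apply: hF => j; rewrite zE normc_real ger0_norm; lra.
  exists B => // k; apply: le_trans (hB k); rewrite normcM ler_wpM2l ?normc_ge0 //.
  rewrite /monomial normc_prod mdegE -prodrXr.
  rewrite [X in _ <= X](eq_bigr (fun i => (r / 2) ^+ k i)) // => j _.
  by rewrite normcX !mxE addrC addKr normc_real ger0_norm; lra.
set S := (2 : R) ^+ s; have S1 : 1 <= S by rewrite exprn_ege1 // ler1n.
have sumS (J : {fset multinom s}) : \sum_(k : J) (2^-1 : R) ^+ mdeg (val k) <= S.
  have := @geometric_fset_sum_le R 2^-1 s J.
  rewrite (_ : (1 - 2^-1)^-1 = 2) //; last by field.
  by apply; lra.
(* on the polydisc of radius r/4 the terms are dominated by a geometric series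
   of ratio 1/2, since they are bounded at radius r/2 *)
have dom k (u : R[i]) (m : R) : normc u <= m * (r / 4) ^+ mdeg k -> 0 <= m ->
    normc (c k * u) <= m * B * 2^-1 ^+ mdeg k.
  move=> um m0; rewrite normcM.
  apply: le_trans (ler_wpM2l (normc_ge0 _) um) _.
  rewrite [r / 4](_ : _ = (r / 2) * 2^-1); last by field.
  rewrite exprMn mulrCA -mulrA ler_wpM2l // mulrA ler_wpM2r ?exprn_ge0 //.
have domsum (u : multinom s -> R[i]) (m : R) (J : {fset multinom s}) : 0 <= m ->
    (forall k, normc (u k) <= m * (r / 4) ^+ mdeg k) ->
    normc (\sum_(k : J) c (val k) * u (val k)) <= m * (B * S).
  move=> m0 um; apply: le_trans (normc_sum _ _ _) _.
  apply: (@le_trans _ _ (\sum_(k : J) m * B * 2^-1 ^+ mdeg (val k))).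
    by apply: ler_sum => k _; exact: dom.
  by rewrite -mulr_sumr -mulrA; do 2! rewrite ler_wpM2l //.
set d := r / 8 in r8 *.
exists d, (1 + B * S * (1 + 2 / d + 2 / d ^+ 2)).
have BS0 : 0 <= B * S by rewrite mulr_ge0 // (le_trans _ S1).
have [di0 dd0] : 0 <= 2 / d /\ 0 <= 2 / d ^+ 2.
  by split; rewrite divr_ge0 ?sqr_ge0 // ltW.
split => //.
  by rewrite lerDl mulr_ge0 // !addr_ge0.
have leC m : m <= B * S * (1 + 2 / d + 2 / d ^+ 2) ->
    m <= 1 + B * S * (1 + 2 / d + 2 / d ^+ 2) by move=> ?; lra.
have BS1 : B * S <= B * S * (1 + 2 / d + 2 / d ^+ 2).
  by rewrite ler_peMr //; lra.
move=> x xd.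
have dr : d <= r / 4 by rewrite /d; lra.
have ddr : d + d = r / 4 by rewrite /d; field.
have inball i w : normc w <= d -> forall j, normc (set_coord x i (x ord0 i + w) ord0 j - a ord0 j) < r.
  move=> wd j; rewrite set_coordE; case: eqP => [->|_]; last first.
    by apply: le_lt_trans (xd j) _; lra.
  rewrite addrAC; apply: le_lt_trans (normcD_le (xd i) wd) _; lra.
pose rest (i : 'I_s) (k : multinom s) := \prod_(j < s | j != i) (x ord0 j - a ord0 j) ^+ k j.
have restP (i : 'I_s) (k : multinom s) (m : R) u : normc u <= m * (r / 4) ^+ k i ->
    normc (u * rest i k) <= m * (r / 4) ^+ mdeg k.
  move=> um.
  have ki : (k i <= mdeg k)%N by rewrite mdegE (bigD1 i) //= leq_addr.
  rewrite -(subnKC ki) exprD mulrA; apply: normcM_le => //.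
  apply: le_trans (prod_normc_le i k xd) _.
  by rewrite lerXn2r ?nnegrE ?(ltW r8) //; lra.
pose mono (i : 'I_s) w (k : multinom s) := (x ord0 i - a ord0 i + w) ^+ k i * rest i k.
have monoE i w k : mono i w k = monomial (set_coord x i (x ord0 i + w) - a) k.
  by rewrite monomial_set_coord addrAC.
pose P (i : 'I_s) (J : {fset multinom s}) w := \sum_(k : J) c (val k) * mono i w (val k).
pose L (i : 'I_s) (J : {fset multinom s}) := \sum_(k : J) c (val k) *
   (((x ord0 i - a ord0 i) ^+ (val k i).-1 *+ (val k i)) * rest i (val k)).
pose Phi (i : 'I_s) w := F (set_coord x i (x ord0 i + w)).
have d0 := ltW r8.
have PB i J w : normc w <= d -> normc (P i J w) <= B * S.
  move=> wd; rewrite -[B * S]mul1r; apply: domsum => // k; apply: restP.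
  rewrite mul1r normcX lerXn2r ?nnegrE ?normc_ge0 -?ddr ?addr_ge0 //.
  exact: normcD_le.
have LB i J : normc (L i J) <= B * S / d.
  rewrite [B * S / d]mulrC.
  apply: (domsum (fun k => ((x ord0 i - a ord0 i) ^+ (k i).-1 *+ k i) * rest i k)) => [|k].
     by rewrite invr_ge0.
  apply: restP; apply: le_trans (expn_deriv_le _ d0 r8 (xd i)) _.
  by rewrite ddr mulrC.
pose M := B * S / d ^+ 2.
have M0 : 0 <= M by rewrite divr_ge0 ?sqr_ge0.
have PT i J w : normc w <= d -> normc (P i J w - P i J 0 - L i J * w) <= M * normc w ^+ 2.
  move=> wd; rewrite /P /L mulr_suml -!sumrB.
  rewrite (eq_bigr (fun k : J => c (val k) * ((((x ord0 i - a ord0 i) + w) ^+ (val k i)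
     - (x ord0 i - a ord0 i) ^+ (val k i) - ((x ord0 i - a ord0 i) ^+ (val k i).-1 *+ (val k i)) * w)
     * rest i (val k)))); last by move=> k _; rewrite /mono addr0; ring.
  apply: le_trans (domsum (fun k => (((x ord0 i - a ord0 i) + w) ^+ (k i)
     - (x ord0 i - a ord0 i) ^+ (k i) - ((x ord0 i - a ord0 i) ^+ (k i).-1 *+ (k i)) * w) * rest i k) ((normc w / d) ^+ 2) J (sqr_ge0 _) _) _.
    move=> k; apply: restP; rewrite -ddr.
    exact: expnD_taylor.
  by rewrite /M expr_div_n le_eqVlt; apply/orP; left; apply/eqP; ring.
have close i (e : R) w w' : 0 < e -> normc w <= d -> normc w' <= d ->
    exists J, [/\ normc (Phi i 0 - P i J 0) <= e, normc (Phi i w - P i J w) <= e &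
                  normc (Phi i w' - P i J w') <= e].
  move=> e0 wd wd'.
  pose pt (o : option bool) := if o is Some q then if q then w else w' else 0.
  have ptd o : normc (pt o) <= d by case: o => [[]|]; rewrite /pt ?normc0r.
  have [J hJ] := @partial_sums_close (option bool)
    (fun o k => c k * monomial (set_coord x i (x ord0 i + pt o) - a) k) (fun o => Phi i (pt o)) e e0
    (fun o => hF _ (inball i (pt o) (ptd o))).
  exists J; split; [have := hJ None|have := hJ (Some true)|have := hJ (Some false)];
    by rewrite /partial_sum /P /=; under eq_bigr do rewrite -monoE.
have PhiB i w : normc w <= d -> normc (Phi i w) <= B * S.
  move=> wd; apply/ler_addgt0Pr => e e0; have [J [_ h _]] := close i e w w e0 wd wd.
  rewrite -[Phi i w](subrK (P i J w)) addrC; apply: normcD_le => //; exact: PB.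
have PhiLip i w : normc w <= d -> normc (Phi i w - Phi i 0) <= 2 * (B * S) / d * normc w.
  move=> wd; apply/ler_addgt0Pr => e e0.
  have [J [h0 h _]] := close i (e / 2) w w (divr_gt0 e0 (ltr0Sn _ 1)) wd wd.
  have -> : Phi i w - Phi i 0 = (P i J w - P i J 0 - L i J * w) + L i J * w +
     ((Phi i w - P i J w) - (Phi i 0 - P i J 0)) by ring.
  apply: le_trans (normcD_le (normcD_le (PT i J w wd) (normcM_le (LB i J) (lexx _)))
     (normcB_le h h0)) _.
  rewrite -splitr lerD2r.
  have : M * normc w ^+ 2 <= B * S / d * normc w.
    rewrite expr2 mulrA ler_wpM2r ?normc_ge0 // /M.
    have -> : B * S / d = B * S / d ^+ 2 * d by field; rewrite gt_eqF.
    by rewrite ler_wpM2l // -/M.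
  lra.
have PhiT i w w' : normc w <= d -> normc w' <= d ->
    normc (w' * (Phi i w - Phi i 0) - w * (Phi i w' - Phi i 0)) <=
    normc w' * (M * normc w ^+ 2) + normc w * (M * normc w' ^+ 2).
  move=> wd wd'; apply/ler_addgt0Pr => e e0.
  have e4 : 0 < e / (4 * d) by rewrite divr_gt0 // mulr_gt0.
  have [J [h0 h h']] := close i (e / (4 * d)) w w' e4 wd wd'.
  have -> : w' * (Phi i w - Phi i 0) - w * (Phi i w' - Phi i 0) =
    w' * (P i J w - P i J 0 - L i J * w) - w * (P i J w' - P i J 0 - L i J * w') +
    (w' * ((Phi i w - P i J w) - (Phi i 0 - P i J 0)) -
     w * ((Phi i w' - P i J w') - (Phi i 0 - P i J 0))) by ring.
  apply: normcD_le; first by apply: normcB_le; apply: normcM_le => //; exact: PT.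
  apply: le_trans (normcB_le (normcM_le wd' (normcB_le h h0)) (normcM_le wd (normcB_le h' h0))) _.
  by rewrite le_eqVlt; apply/orP; left; apply/eqP; field; rewrite gt_eqF.
have FB : normc (F x) <= B * S.
  apply/ler_addgt0Pr => e e0.
  have xr j : normc (x ord0 j - a ord0 j) < r by apply: le_lt_trans (xd j) _; lra.
  have [J /(_ tt) hJ] := @partial_sums_close unit
    (fun _ k => c k * monomial (x - a) k) (fun _ => F x) e e0 (fun _ => hF _ xr).
  rewrite -[F x](subrK (\sum_(k : J) c (val k) * monomial (x - a) (val k))) addrC.
  apply: normcD_le => //; rewrite -[B * S]mul1r; apply: domsum => // k.
  rewrite mul1r /monomial normc_prod mdegE -prodrXr; apply: ler_prod => j _.
  rewrite normc_ge0 normcX !mxE lerXn2r ?nnegrE ?normc_ge0 ?(le_trans (xd j)) //; lra.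
split; first exact: leC (le_trans FB BS1).
move=> i t /andP[t0 td].
have tn : normc t%:C = t by rewrite normc_real ger0_norm // ltW.
have t_neq0 : t%:C != 0 by rewrite -normc_eq0 tn gt_eqF.
exists ((Phi i t%:C - Phi i 0) / t%:C).
  apply: leC; rewrite normcM normcV tn ler_pdivrMr //.
  apply: le_trans (PhiLip i t%:C _) _; rewrite tn // ler_wpM2r ?(ltW t0) //.
  rewrite -mulrA mulrCA ler_wpM2l //.
  by move: dd0 di0; lra.
move=> v vt; rewrite -/(Phi i v) -/(Phi i 0) -(ler_pM2l t0) -{1}tn -normcM.
have -> : t%:C * (Phi i v - Phi i 0 - (Phi i t%:C - Phi i 0) / t%:C * v) =
  t%:C * (Phi i v - Phi i 0) - v * (Phi i t%:C - Phi i 0) by field.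
have vd := le_trans vt td.
apply: le_trans (PhiT i v t%:C vd _) _; rewrite tn //.
apply: (@le_trans _ _ (t * (2 * M * t ^+ 2))).
  have : t * (M * normc v ^+ 2) <= t * (M * t ^+ 2).
    by rewrite !ler_wpM2l ?(ltW t0) // lerXn2r ?nnegrE ?normc_ge0 ?(ltW t0).
  have : normc v * (M * t ^+ 2) <= t * (M * t ^+ 2).
    by rewrite ler_wpM2r // mulr_ge0 ?sqr_ge0.
  lra.
rewrite ler_wpM2l ?(ltW t0) // ler_wpM2r ?sqr_ge0 //; apply: leC.
rewrite [2 * M](_ : _ = B * S * (2 / d ^+ 2)); last by rewrite /M; ring.
by rewrite ler_wpM2l //; move: di0; lra.
Qed.

End LocalAnalytic.

(** * Uniform estimates by compactness *)

(** Compactness of the box, in the form of near coverings: a monotone property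
    that holds locally from some rank on holds everywhere from some rank on. *)
Lemma box_uniform (R : realType) n (B : R) (P : nat -> 'rV[R]_n -> Prop) :
  (forall v m m', (m <= m')%N -> P m v -> P m' v) ->
  (forall a : 'rV[R]_n, exists (e : R) m, 0 < e /\
     forall v : 'rV[R]_n, (forall j, `|a ord0 j - v ord0 j| < e) -> P m v) ->
  exists m, forall v : 'rV[R]_n, (forall j, `|v ord0 j| <= B) -> P m v.
Proof.
move=> Pmono Ploc.
have cB : compact [set v : 'rV[R]_n | forall j, `[- B, B]%classic (v ord0 j)].
  by apply: (@rV_compact _ _ (fun=> `[- B, B]%classic)) => j; exact: segment_compact.
have /compact_near_coveringP/(_ nat \oo P _) := cB.
case=> [v _|m _ /(_ m (leqnn m)) hm].
  have [e [m [e0 hP]]] := Ploc v.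
  exists (ball v e, [set m' | (m <= m')%N]).
    by split; [exact: nbhsx_ballx|exists m].
  move=> [v' m'] /= [bv mm]; apply: Pmono mm _; apply: hP => j.
  by case: bv => _ /(_ ord0 j); rewrite -ball_normE.
exists m => v vB; apply: hm => j /=; rewrite in_itv /=.
by have := vB j; rewrite ler_norml.
Qed.

Section Uniform.
Context {R : realType} {s : nat}.
Implicit Types (x a b : 'rV[R[i]]_s) (F : 'rV[R[i]]_s -> R[i]).

(** The ellipse condition coordinate by coordinate: by the triangle inequality
    small gauge implies membership in the region, and the gauge is additive and
    explicit in Joukowski coordinates. *)
Definition gauge x : R := \sum_(j < s) (normc (x ord0 j ^+ 2) + normc (x ord0 j ^+ 2 - 1)).

Lemma gauge_term_ge0 x j : 0 <= normc (x ord0 j ^+ 2) + normc (x ord0 j ^+ 2 - 1).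
Proof. by rewrite addr_ge0 ?normc_ge0. Qed.

Lemma gauge_local a (e : R) : e < gauge a ->
  exists2 d : R, 0 < d & forall x, (forall j, normc (x ord0 j - a ord0 j) <= d) -> e < gauge x.
Proof.
move=> ea; pose A := 1 + \sum_(j < s) normc (a ord0 j).
have A1 : 1 <= A by rewrite lerDl sumr_ge0 // => j _; exact: normc_ge0.
have aA j : normc (a ord0 j) <= A.
  rewrite /A (bigD1 j) //= addrCA lerDl addr_ge0 // sumr_ge0 // => ? _; exact: normc_ge0.
pose S := (s%:R * 6 * A + 1 : R).
have S0 : 0 < S by rewrite ltr_wpDl // !mulr_ge0 // (le_trans _ A1).
pose d := Num.min 1 ((gauge a - e) / S).
have d0 : 0 < d by rewrite lt_min ltr01 divr_gt0 // subr_gt0.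
have [d1 dS] : d <= 1 /\ d * S <= gauge a - e.
  by rewrite -ler_pdivlMr //; split; rewrite /d ge_min lexx ?orbT.
exists d => // x xd.
suff : gauge a - gauge x <= s%:R * 6 * A * d.
  rewrite [X in _ <= X](_ : _ = d * S - d); last by rewrite /S; ring.
  move: dS d0; generalize (d * S) d (gauge a) (gauge x) => *; lra.
rewrite /gauge -sumrB.
apply: (@le_trans _ _ (\sum_(j < s) 6 * A * d)); last first.
  by rewrite sumr_const card_ord -[X in X <= _]mulr_natl !mulrA.
apply: ler_sum => j _.
have aD z w : normc (z : R[i]) - normc w <= normc (w - z).
  rewrite lerBlDr normcB.
  by rewrite -{1}[z](subrK w) ler_normcD.
have h1 := aD (a ord0 j ^+ 2) (x ord0 j ^+ 2).
have h2 := aD (a ord0 j ^+ 2 - 1) (x ord0 j ^+ 2 - 1).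
have h : normc (x ord0 j ^+ 2 - a ord0 j ^+ 2) <= d * (3 * A).
  rewrite subr_sqr; apply: normcM_le => //.
  have -> : x ord0 j + a ord0 j = (x ord0 j - a ord0 j) + 2%:R * a ord0 j by ring.
  apply: le_trans (normcD_le (xd j) (normcM_le (lexx _) (aA j))) _.
  by rewrite normc_nat; lra.
have e2 : x ord0 j ^+ 2 - 1 - (a ord0 j ^+ 2 - 1) = x ord0 j ^+ 2 - a ord0 j ^+ 2 by ring.
rewrite e2 in h2; lra.
Qed.

Lemma gauge_coord_le x (e : R) j : gauge x <= e -> normc (x ord0 j) <= e + 1.
Proof.
move=> xe.
have h : normc (x ord0 j) ^+ 2 <= e.
  apply: le_trans xe; rewrite /gauge (bigD1 j) //= -normcX -addrA lerDl.
  by rewrite addr_ge0 ?normc_ge0 // sumr_ge0 // => k _; exact: gauge_term_ge0.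
have := normc_ge0 (x ord0 j); have := sqr_ge0 (normc (x ord0 j)); nra.
Qed.

(** Real coordinates of complex points; compactness is available for boxes of
    real row vectors. *)
Definition of_reals (v : 'rV[R]_(s + s)) : 'rV[R[i]]_s :=
  \row_j ((v ord0 (lshift s j)) +i* (v ord0 (rshift s j)))%C.

(** A point of the box either has gauge below [e'], where analyticity gives
    local estimates, or has gauge above [e] in a whole neighbourhood, where there
    is nothing to prove. *)
Lemma uniform_analytic F (e e' : R) : e < e' ->
  (forall x, gauge x < e' -> analytic_at F x) ->
  exists C d : R, [/\ 1 <= C, 0 < d <= 1 & forall x, gauge x <= e ->
    normc (F x) <= C /\
    forall i, nearly_linear C d (fun w => F (set_coord x i (x ord0 i + w)))].
Proof.
move=> ee Fan.
pose good x (C d : R) := normc (F x) <= C /\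
    forall i, nearly_linear C d (fun w => F (set_coord x i (x ord0 i + w))).
have goodS x C C' d d' : C <= C' -> d' <= d -> good x C d -> good x C' d'.
  move=> CC dd [h1 h2]; split; first exact: le_trans CC.
  by move=> i; apply: nearly_linear_le (h2 i).
pose P m (v : 'rV[R]_(s + s)) := gauge (of_reals v) <= e -> good (of_reals v) m.+1%:R m.+1%:R^-1.
have [m hm] : exists m, forall v : 'rV[R]_(s + s), (forall j, `|v ord0 j| <= e + 1) -> P m v.
  apply: box_uniform => [v m m' mm h ve|a].
    apply: goodS (h ve); first by rewrite ler_nat ltnS.
    by rewrite lef_pV2 ?posrE // ler_nat ltnS.
  have loc : exists (r C : R), [/\ 0 < r, 1 <= C & forall x,
      (forall j, normc (x ord0 j - of_reals a ord0 j) <= r) -> gauge x <= e -> good x C r].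
    have [ae|ae] := ltP (gauge (of_reals a)) e'.
      have [r [C [r0 C1 h]]] := analytic_at_local (Fan _ ae).
      by exists r, C; split => // x /h.
    have [d d0 h] := gauge_local (lt_le_trans ee ae).
    exists d, 1; split => // x /h; by rewrite ltNge => /negP.
  have [r [C [r0 C1 h]]] := loc.
  have [m mC] : exists m, C <= m.+1%:R /\ m.+1%:R^-1 <= r.
    exists (Num.truncn (C + r^-1)).
    have lt1 : C + r^-1 < (Num.truncn (C + r^-1)).+1%:R := truncnS_gt _; split.
      by apply: le_trans (ltW lt1); rewrite lerDl invr_ge0 ltW.
    rewrite invf_ple ?posrE ?ltr0n //.
    by apply: le_trans (ltW lt1); rewrite lerDr; lra.
  exists (r / 2), m; split; first exact: divr_gt0.
  move=> v va ve; apply: goodS (mC.1) (mC.2) (h _ _ ve) => j.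
  rewrite !mxE.
  have -> : ((v ord0 (lshift s j) +i* v ord0 (rshift s j)) -
             (a ord0 (lshift s j) +i* a ord0 (rshift s j)))%C =
     (v ord0 (lshift s j) - a ord0 (lshift s j))%:C +
     'i * (v ord0 (rshift s j) - a ord0 (rshift s j))%:C.
    by simpc.
  apply: le_trans (ler_normcD _ _) _.
  rewrite normcM !normc_real [normc 'i](_ : _ = 1); last first.
    by rewrite /normc /= expr0n expr1n add0r sqrtr1.
  rewrite mul1r distrC [X in _ + X]distrC.
  have := va (lshift s j); have := va (rshift s j); lra.
exists m.+1%:R, m.+1%:R^-1; split.
- by rewrite ler1n.
- by rewrite invr_gt0 ltr0n /= invf_le1 ?ler1n ?ltr0n.
move=> x xe; pose v : 'rV[R]_(s + s) :=
  row_mx (\row_j complex.Re (x ord0 j)) (\row_j complex.Im (x ord0 j)).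
have vE : of_reals v = x.
  by apply/rowP => j; rewrite mxE row_mxEl row_mxEr !mxE; case: (x ord0 j).
have := hm v; rewrite /P vE => /(_ _ xe); apply => j.
rewrite -(splitK j) /=; case: (fintype.split j) => k /=; rewrite ?row_mxEl ?row_mxEr mxE;
  apply: le_trans (gauge_coord_le k xe); rewrite -lecR -normc_norm.
- exact: normc_ge_Re.
- by rewrite normc_def lecR -sqrtr_sqr ler_wsqrtr // lerDr sqr_ge0.
Qed.
End Uniform.

(** * Geometry of the region in Joukowski coordinates *)

Section Hyperbolic.
Context {R : realType}.
Implicit Types (x y l : R).

(** That is, cosh(l x) - 1 <= l^2 (cosh x - 1), which holds term by term in the
    power series because only even exponents from 2 on occur. *)
Lemma cosh_scale_le x l : 0 <= l <= 1 ->
  expR (l * x) + expR (- (l * x)) - 2 <= l ^+ 2 * (expR x + expR (- x) - 2).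
Proof.
move=> /andP[l0 l1].
have cE (z : R) : series (exp_coeff z) n @[n --> \oo] --> expR z by exact: is_cvg_series_exp_coeff.
apply: (@ler_cvg_to _ \oo _ _
  (fun n => series (exp_coeff (l * x)) n + series (exp_coeff (- (l * x))) n - 2)
  (fun n => l ^+ 2 * (series (exp_coeff x) n + series (exp_coeff (- x)) n - 2))).
- by apply: cvgB; [apply: cvgD; exact: cE|exact: cvg_cst].
- by apply: cvgMr; apply: cvgB; [apply: cvgD; exact: cE|exact: cvg_cst].
near=> n; have n0 : (0 < n)%N by near: n; exists 1%N.
rewrite -(prednK n0) /series /= -!big_split !big_nat_recl //= /exp_coeff /=.
rewrite !expr0 fact0 invr1 !mulr1 -[1 + 1]/(2 : R) ![2 + _]addrC !addrK mulr_sumr.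
apply: ler_sum => m _; rewrite -!mulrDl mulrA ler_wpM2r ?invr_ge0 //.
rewrite [(- _) ^+ _]exprNn [(- x) ^+ _]exprNn -signr_odd; case: m => [|m].
  by rewrite /= !expr1 !mulN1r !subrr mulr0.
case o : (odd _); first by rewrite expr1 !mulN1r !subrr mulr0.
rewrite expr0 !mul1r -!mulr2n mulrnAr lerMn2r /= exprMn ler_wpM2r //.
  by rewrite exprn_even_ge0 // o.
by rewrite -[X in _ <= X]mul1r -addn2 exprD ler_wpM2r ?sqr_ge0 // exprn_ile1.
Unshelve. all: by end_near.
Qed.

Lemma parallelogram (a b : R[i]) :
  normc (a + b) ^+ 2 + normc (a - b) ^+ 2 = 2 * (normc a ^+ 2 + normc b ^+ 2).
Proof. by rewrite !normc_sqrE; case: a => a1 a2; case: b => b1 b2 /=; ring. Qed.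

(** J(z)^2 and J(z)^2 - 1 are the squares of (z + 1/z)/2 and (z - 1/z)/2, so this
    is the parallelogram law. *)
Lemma joukowski_gauge (z : R[i]) : z != 0 ->
  normc (joukowski z ^+ 2) + normc (joukowski z ^+ 2 - 1) =
  (normc z ^+ 2 + (normc z)^-1 ^+ 2) / 2.
Proof.
move=> z0.
have -> : joukowski z ^+ 2 - 1 = ((z - z^-1) / 2%:R) ^+ 2.
  by rewrite /joukowski; field.
rewrite !normcX /joukowski !normcM !exprMn -mulrDl parallelogram normc_half normcV.
by field; rewrite normc_eq0.
Qed.

Lemma gauge_joukowskiv s (z : 'rV[R[i]]_s) : (forall i, z ord0 i != 0) ->
  gauge (joukowskiv z) = \sum_i (normc (z ord0 i) ^+ 2 + (normc (z ord0 i))^-1 ^+ 2) / 2.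
Proof. by move=> z0; apply: eq_bigr => i _; rewrite mxE joukowski_gauge. Qed.

Lemma gauge_region s (x : 'rV[R[i]]_s) (h : R) :
  gauge x < s%:R + 2 * h ^+ 2 -> region h x.
Proof.
move=> xh; rewrite /region /ellipse /=; apply: le_lt_trans xh.
rewrite /gauge big_split /= lerD ?normc_sum //.
rewrite [X in normc X](_ : _ = \sum_(j < s) (x ord0 j ^+ 2 - 1)) ?normc_sum //.
by rewrite sumrB sumr_const card_ord rmorph_nat.
Qed.

Lemma unit_radius_gauge_mono (u t : R) : 0 < t -> t <= u <= 1 ->
  u ^+ 2 + u^-1 ^+ 2 <= t ^+ 2 + t^-1 ^+ 2.
Proof.
move=> t0 /andP[tu u1]; have u0 : 0 < u by exact: lt_le_trans tu.
rewrite -subr_ge0.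
have -> : t ^+ 2 + t^-1 ^+ 2 - (u ^+ 2 + u^-1 ^+ 2) =
  (u ^+ 2 - t ^+ 2) * ((u * t)^-1 ^+ 2 - 1).
  by field; rewrite !gt_eqF.
rewrite mulr_ge0 ?subr_ge0 //.
  by rewrite lerXn2r ?nnegrE // ltW.
by rewrite exprn_ege1 // invf_ge1 ?mulr_gt0 // mulr_ile1 ?(ltW u0) ?(ltW t0) // (le_trans tu).
Qed.

(** With x = 2 y in [cosh_scale_le]: the excess over [s] is at most 2 sinh(y)^2
    times the sum of the squares of the [l i]. *)
Lemma gauge_radii s (y : R) (l : 'I_s -> R) : 0 <= y -> (forall i, 0 <= l i <= 1) ->
  \sum_i l i ^+ 2 <= 1 ->
  \sum_i (expR (- (l i * y)) ^+ 2 + (expR (- (l i * y)))^-1 ^+ 2) / 2 <=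
  s%:R + (expR y - (expR y)^-1) ^+ 2 / 2.
Proof.
move=> y0 l01 l2.
have E z : expR z ^+ 2 = expR (2 * z) by rewrite expRM_natl.
apply: (@le_trans _ _ (\sum_i (1 + l i ^+ 2 * ((expR y - (expR y)^-1) ^+ 2 / 2)))).
  apply: ler_sum => i _; have := cosh_scale_le (2 * y) (l01 i).
  rewrite -!expRN !E !mulrN opprK [2 * (l i * y)]mulrCA.
  have -> : (expR y - (expR (- y))) ^+ 2 = expR (2 * y) + expR (- (2 * y)) - 2.
    rewrite sqrrB !E mulrN -expRD subrr expR0; ring.
  lra.
rewrite big_split /= sumr_const card_ord -mulr_suml lerD2l ler_piMl //.
by rewrite divr_ge0 ?sqr_ge0.
Qed.

End Hyperbolic.

Section Continuation.
Context {R : realType} {s : nat}.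
Implicit Types (F : 'rV[R[i]]_s -> R[i]).

Lemma joukowskiv_set_coord (z : 'rV[R[i]]_s) i u :
  joukowskiv (set_coord z i u) = set_coord (joukowskiv z) i (joukowski u).
Proof. by apply/rowP => j; rewrite !(mxE, set_coordE); case: eqP. Qed.

Lemma joukowski_taylor (z v : R[i]) (A : R) : z != 0 -> 1 <= A -> normc z <= 1 ->
  (normc z)^-1 <= A -> normc v <= 2^-1 ->
  normc (joukowski (z * (1 + v)) - joukowski z - (z - z^-1) / 2%:R * v) <= A * normc v ^+ 2.
Proof.
move=> z0 A1 z1 zA v2.
have nv : 2^-1 <= normc (1 + v).
  have := ler_normcB (1 + v) v; rewrite addrK normc1r; lra.
have v1 : 1 + v != 0 by rewrite -normc_eq0 gt_eqF //; lra.
have -> : joukowski (z * (1 + v)) - joukowski z - (z - z^-1) / 2%:R * v =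
  z^-1 * (v ^+ 2 * ((1 + v)^-1 / 2%:R)).
  by rewrite /joukowski; field; rewrite z0 v1.
rewrite normcM normcV ler_pM ?invr_ge0 ?normc_ge0 //.
rewrite normcM normcX ler_piMr ?sqr_ge0 // normcM normc_half normcV.
rewrite ler_pdivrMr // mul1r invf_ple ?posrE //; lra.
Qed.

(** What is used of analyticity: first-order expansions in each coordinate,
    with constants uniform on a sublevel set of the gauge. *)
Definition uniformly_smooth F (e C d : R) := forall x, gauge x <= e ->
    normc (F x) <= C /\
    forall i, nearly_linear C d (fun w => F (set_coord x i (x ord0 i + w))).

(** The integrand of the coefficient integral with respect to dz / z. *)
Definition pullback F (k : 'I_s -> nat) (z : 'rV[R[i]]_s) :=
  F (joukowskiv z) * \prod_i z ord0 i ^+ k i.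

(** Near z the function is the product of a constant, of [F] composed with the
    Joukowski map in one coordinate, and of a power of 1 + v. *)
Lemma pullback_smooth F e C d k : 0 <= e -> 1 <= C -> 0 < d -> uniformly_smooth F e C d ->
  exists C' d', [/\ 0 <= C', 0 < d' & forall z : 'rV[R[i]]_s,
    (forall i, 0 < normc (z ord0 i) <= 1) -> gauge (joukowskiv z) <= e ->
    forall i, nearly_linear C' d' (fun v => pullback F k (set_coord z i (z ord0 i * (1 + v))))].
Proof.
move=> e0 C1 d0 HF; pose A := 2 * e + 1; have A1 : 1 <= A by rewrite /A; lra.
pose C1' := C * (4 * A ^+ 2 + A); pose d' := Num.min 2^-1 (d / (2 * A)).
have C1'g : C <= C1'.
  by rewrite ler_peMr ?(le_trans _ C1) //; have := sqr_ge0 A; lra.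
pose m := (\max_i k i)%N.
have d'1 : d' <= 1 by rewrite /d' ge_min; apply/orP; left; lra.
have G0 : 0 <= 6 * (C1' * 2 ^+ m).
  apply: mulr_ge0 => //; apply: mulr_ge0; last exact: exprn_ge0.
  by apply: le_trans C1'g; apply: le_trans C1.
exists (6 * (C1' * 2 ^+ m)), d'; split.
- exact: G0.
- by rewrite lt_min divr_gt0 ?mulr_gt0 //=; lra.
move=> z z01 ze i.
have z0 j : z ord0 j != 0 by rewrite -normc_eq0 gt_eqF //; case/andP: (z01 j).
have zA : (normc (z ord0 i))^-1 <= A.
  have : (normc (z ord0 i))^-1 ^+ 2 / 2 <= e.
    apply: le_trans ze; rewrite gauge_joukowskiv // (bigD1 i) //=.
    have : 0 <= \sum_(j < s | j != i) (normc (z ord0 j) ^+ 2 + (normc (z ord0 j))^-1 ^+ 2) / 2.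
      by apply: sumr_ge0 => j _; rewrite divr_ge0 // addr_ge0 ?sqr_ge0.
    have := sqr_ge0 (normc (z ord0 i)); lra.
  have : 0 <= (normc (z ord0 i))^-1 by rewrite invr_ge0 normc_ge0.
  rewrite /A; nra.
pose w v := joukowski (z ord0 i * (1 + v)) - joukowski (z ord0 i).
have /andP[_ zi1] := z01 i.
pose x := joukowskiv z.
pose H1 v := F (set_coord x i (x ord0 i + w v)).
pose c := \prod_j z ord0 j ^+ k j.
have c1 : normc c <= 1.
  rewrite normc_prod; apply: prodr_ile1 => j _; rewrite normcX exprn_ge0 ?normc_ge0 //=.
  by rewrite exprn_ile1 ?normc_ge0 //; case/andP: (z01 j).
have [Fx Fi] := HF x ze.
have NL1 : nearly_linear C1' d' H1.
  apply: (nearly_linear_comp (H := fun u => F (set_coord x i (x ord0 i + u))) (w := w)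
    (l := (z ord0 i - (z ord0 i)^-1) / 2%:R) _ A1) (Fi i).
  - exact: le_trans C1.
  - rewrite normcM normc_half ler_pdivrMr //.
    by apply: le_trans (ler_normcB _ _) _; rewrite normcV; lra.
  - by rewrite /w addr0 mulr1 subrr.
  - by move=> v v2; exact: joukowski_taylor.
have H10 : normc (H1 0) <= C1'.
  by rewrite /H1 /w addr0 mulr1 subrr addr0 set_coord_id (le_trans Fx).
have NL2 : nearly_linear (2 ^+ m) d' (fun v : R[i] => (1 + v) ^+ k i).
  apply: nearly_linear_le (nearly_linear_pow (k i)) => //.
  by rewrite ler_weXn2l ?ler1n // /m leq_bigmax.
have NL := nearly_linearM (le_trans C1 C1'g) (exprn_ege1 _ _) d'1 H10 _ NL1 NL2.
have {}NL : nearly_linear (6 * (C1' * 2 ^+ m)) d' (fun v => c * (H1 v * (1 + v) ^+ k i)).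
  apply: nearly_linear_cst c1 _ (NL _ _).
  - exact: G0.
  - by rewrite ler1n.
  - by rewrite addr0 expr1n normc1r exprn_ege1 // ler1n.
have E v : pullback F k (set_coord z i (z ord0 i * (1 + v))) = c * (H1 v * (1 + v) ^+ k i).
  have -> : H1 v = F (set_coord x i (joukowski (z ord0 i * (1 + v)))).
    by rewrite /H1 /w [x ord0 i]mxE addrC subrK.
  rewrite /pullback joukowskiv_set_coord -/x.
  rewrite mulrCA; congr (_ * _); rewrite /c (bigD1 i) //= [in RHS](bigD1 i) //=.
  rewrite set_coordE eqxx exprMn -!mulrA; congr (_ * _); rewrite mulrC; congr (_ * _).
  by apply: eq_bigr => j /negbTE ji; rewrite set_coordE ji.
move=> t td; have [L LC HL] := NL t td; exists L => // v vt.
by rewrite !E; exact: HL.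
Qed.

End Continuation.

(** * Decay of the grid coefficients *)

Section Decay.
Context {R : realType} {s : nat}.
Implicit Types (F : 'rV[R[i]]_s -> R[i]).

Definition grid_coef F N w (k : 'I_s -> nat) : R[i] :=
  grid_mean (N := N) (fun j => F (joukowskiv (torus_pt w (fun=> 1) j)) * \prod_i cheb_val (k i) (w ^+ j i)).

(** The radius [expR (- b i)] is reached in L steps of ratio
    [expR (- (b i / L))], with L just large enough for the radial step to be
    shorter than the angular one; L is then of order 1 / |w - 1|, while each
    step costs O(|w - 1|^2). *)
Lemma grid_coef_le F (e C d : R) (k : 'I_s -> nat) (b : 'I_s -> R) (eps : R) :
  0 <= e -> 1 <= C -> 0 < d -> uniformly_smooth F e C d -> (forall i, 0 <= b i) ->
  \sum_i (expR (- b i) ^+ 2 + (expR (- b i))^-1 ^+ 2) / 2 <= e -> 0 < eps ->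
  exists2 t0 : R, 0 < t0 & forall N (w : R[i]), w ^+ N.+1 = 1 -> w != 1 -> normc w = 1 ->
    normc (w - 1) <= t0 ->
    normc (grid_coef F N w k) <= C * \prod_i expR (- b i) ^+ k i + eps.
Proof.
move=> e0 C1 d0 HF b0 be eps0.
have [C' [d' [C'0 d'0 smooth]]] := pullback_smooth k e0 C1 d0 HF.
pose B := \sum_i b i.
have B0 : 0 <= B by apply: sumr_ge0 => i _.
have bB i : b i <= B by rewrite /B (bigD1 i) //= lerDl sumr_ge0.
pose D := s%:R * (28 * C' * (B + 1)) + 1.
have D0 : 0 < D by rewrite ltr_wpDl // !mulr_ge0 // addr_ge0.
exists (Num.min 1 (Num.min (d' / 3) (eps / D))).
  by rewrite !lt_min ltr01 !divr_gt0.
move=> N w wN w1 nw; rewrite !le_min => /andP[t1 /andP[td tD]].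
set t := normc (w - 1) in t1 td tD *.
have t_gt0 : 0 < t by rewrite lt_def normc_ge0 andbT normc_eq0 subr_eq0.
have w0 : w != 0 by exact: unit_neq0.
(* a number of steps that keeps the radial step below t *)
pose L := (Num.truncn (B / t)).+1.
have L0 : (0 < L%:R :> R) by rewrite ltr0n.
have BL : B / t < L%:R by exact: truncnS_gt.
have LB : L%:R <= B / t + 1.
  by rewrite /L -natr1 lerD2r truncn_le // divr_ge0 // ltW.
pose r i := expR (- (b i / L%:R)).
have rL i : r i ^+ L = expR (- b i).
  by rewrite -expRM_natl; congr expR; field; rewrite gt_eqF.
have r1 i : r i <= 1 by rewrite -expR0 ler_expR oppr_le0 divr_ge0 // ltW.
have rt i : `|r i - 1| <= t.
  rewrite ler0_norm ?subr_le0 // opprB.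
  have := expR_ge1Dx (- (b i / L%:R)); rewrite -/(r i).
  have : b i / L%:R <= t.
    rewrite ler_pdivrMr // mulrC -ler_pdivrMr //.
    by apply: le_trans (ltW BL); rewrite ler_wpM2r ?invr_ge0 // ltW.
  lra.
rewrite /grid_coef grid_mean_cheb_val //.
have gn y j i : 0 < y i -> normc (torus_pt (N := N) w y j ord0 i) = y i.
  by move=> y0; rewrite mxE normcM normcX nw expr1n mulr1 normc_real gtr0_norm.
have dom y : (forall i, expR (- b i) <= y i <= 1) -> forall j,
    (forall i, 0 < normc (torus_pt (N := N) w y j ord0 i) <= 1) /\
    gauge (joukowskiv (torus_pt (N := N) w y j)) <= e.
  move=> yb j; have y0 i : 0 < y i.
    by case/andP: (yb i) => h _; apply: lt_le_trans h; exact: expR_gt0.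
  split; first by move=> i; rewrite gn // y0 /=; case/andP: (yb i).
  rewrite gauge_joukowskiv; last by move=> i; rewrite -normc_eq0 gn // gt_eqF.
  apply: le_trans be; apply: ler_sum => i _; rewrite gn // ler_wpM2r ?invr_ge0 //.
  by apply: unit_radius_gauge_mono; rewrite ?expR_gt0.
have tb1 i : expR (- b i) <= expR (- b i) <= 1.
  by rewrite lexx /= -expR0 ler_expR oppr_le0.
have sh := grid_mean_shift (N := N) (G := pullback F k) (t := fun i => expR (- b i)) (r := r)
   (C := C') (d := d') (L := L) wN w1 C'0 t1.
have {}sh := sh _ _ _.
have h1 : normc (grid_mean (N := N) (pullback F k \o torus_pt w (fun=> 1)) -
      grid_mean (N := N) (pullback F k \o torus_pt w (fun i => expR (- b i)))) <= eps.
  apply: le_trans (sh _ _ _) _.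
  - by rewrite -ler_pdivlMl // mulrC.
  - by move=> i; split => //; rewrite ?expR_gt0 // rL.
  - move=> y yb i j; have [z01 ze] := dom y yb j; exact: smooth.
  rewrite -/t.
  have : D * t <= eps by rewrite mulrC -ler_pdivlMr.
  apply: le_trans.
  have -> : D * t = s%:R * (28 * C' * (B + 1)) * t + t by rewrite /D; ring.
  apply: (@le_trans _ _ (s%:R * (28 * C' * (B + 1)) * t)); last by rewrite lerDl ltW.
  rewrite -!mulrA ler_wpM2l // mulrCA ler_wpM2l // mulrCA ler_wpM2l //.
  rewrite expr2 mulrA ler_wpM2r ?(ltW t_gt0) //.
  apply: le_trans (ler_wpM2r (ltW t_gt0) LB) _.
  by rewrite mulrDl mul1r divfK ?gt_eqF // lerD2l.
have h2 : normc (grid_mean (N := N) (pullback F k \o torus_pt w (fun i => expR (- b i)))) <=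
    C * \prod_i expR (- b i) ^+ k i.
  apply: grid_mean_le => j /=; have [_ ze] := dom _ tb1 j.
  apply: normcM_le; first by case: (HF _ ze).
  rewrite normc_prod le_eqVlt; apply/orP; left; apply/eqP; apply: eq_bigr => i _.
  by rewrite normcX gn // expR_gt0.
rewrite [X in normc X](_ : _ = grid_mean (N := N) (pullback F k \o torus_pt w (fun=> 1))); last first.
  congr (_ * _); apply: eq_bigr => j _ /=; congr (_ * _); apply: eq_bigr => i _.
  by rewrite mxE mul1r.
rewrite -[X in normc X](subrK (grid_mean (N := N) (pullback F k \o torus_pt w (fun i => expR (- b i))))).
by rewrite addrC; exact: normcD_le.
Qed.

Definition euclid (k : 'I_s -> nat) : R := Num.sqrt (\sum_i (k i)%:R ^+ 2).

Lemma euclid_ge k i : (k i)%:R <= euclid k.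
Proof.
rewrite -[(k i)%:R](@ger0_norm R) // -sqrtr_sqr ler_wsqrtr // (bigD1 i) //= lerDl.
by apply: sumr_ge0 => j _; exact: sqr_ge0.
Qed.

(** The radii are proportional to [k] in logarithmic scale, the choice that
    makes the sum of the [k i * b i] equal to [y] times the Euclidean norm. *)
Lemma grid_coef_decay F (C d y : R) (k : 'I_s -> nat) (eps : R) :
  1 <= C -> 0 < d -> 0 <= y ->
  uniformly_smooth F (s%:R + (expR y - (expR y)^-1) ^+ 2 / 2) C d -> 0 < eps ->
  exists2 t0 : R, 0 < t0 & forall N (w : R[i]), w ^+ N.+1 = 1 -> w != 1 -> normc w = 1 ->
    normc (w - 1) <= t0 ->
    normc (grid_coef F N w k) <= C * expR (- (y * euclid k)) + eps.
Proof.
move=> C1 d0 y0 HF eps0.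
have E0 : 0 <= euclid k by exact: sqrtr_ge0.
have E2 : euclid k ^+ 2 = \sum_i (k i)%:R ^+ 2.
  by rewrite sqr_sqrtr // sumr_ge0 // => i _; exact: sqr_ge0.
pose l i := (k i)%:R / euclid k.
have l01 i : 0 <= l i <= 1.
  rewrite divr_ge0 //= /l; have [->|E_neq0] := eqVneq (euclid k) 0.
    by rewrite invr0 mulr0.
  by rewrite ler_pdivrMr ?mul1r ?euclid_ge // lt_def E_neq0.
have l2 : \sum_i l i ^+ 2 <= 1.
  under eq_bigr do rewrite expr_div_n.
  rewrite -mulr_suml -E2; have [->|E_neq0] := eqVneq (euclid k) 0.
    by rewrite expr0n mul0r.
  by rewrite mulfV // expf_neq0.
have e0 : 0 <= s%:R + (expR y - (expR y)^-1) ^+ 2 / 2.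
  by rewrite addr_ge0 // divr_ge0 // sqr_ge0.
have b0 i : 0 <= l i * y by rewrite mulr_ge0 //; case/andP: (l01 i).
have [t0 t00 H] := grid_coef_le k e0 C1 d0 HF b0 (gauge_radii y0 l01 l2) eps0.
exists t0 => // N w wN w1 nw wt; apply: le_trans (H N w wN w1 nw wt) _.
rewrite le_eqVlt; apply/orP; left; apply/eqP; congr (_ * _ + _).
transitivity (\prod_i expR ((k i)%:R * - (l i * y))).
  by apply: eq_bigr => i _; rewrite expRM_natl.
rewrite -expR_sum; congr expR.
rewrite (eq_bigr (fun i => (k i)%:R ^+ 2 * (- (y / euclid k)))); last first.
  by move=> i _; rewrite /l; ring.
rewrite -mulr_suml -E2; have [->|E_neq0] := eqVneq (euclid k) 0.
  by rewrite expr0n mul0r mulr0 oppr0.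
by field.
Qed.

End Decay.

(** * Multivariate Chebyshev polynomials *)

Section ChebyshevPoly.
Context {R : realType} {s : nat}.
Implicit Types (p q : mpoly s R[i]) (k : 'I_s -> nat).

Definition supp_le k p := forall m, m \in msupp p -> forall j, (m j <= k j)%N.

Lemma supp_le_trans k k' p : (forall j, (k j <= k' j)%N) -> supp_le k p -> supp_le k' p.
Proof. by move=> kk kp m mp j; apply: leq_trans (kk j); exact: kp. Qed.

Lemma supp_leB k p q : supp_le k p -> supp_le k q -> supp_le k (p - q).
Proof.
by move=> kp kq m /msuppB_le; rewrite mem_cat => /orP[/kp|/kq].
Qed.

Lemma supp_leM k k' p q : supp_le k p -> supp_le k' q ->
  supp_le (fun j => k j + k' j)%N (p * q).
Proof.
move=> kp kq m /msuppM_le/allpairsP[[m1 m2] /= [m1p m2q ->]] j.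
by rewrite mnmDE leq_add ?kp ?kq.
Qed.

Lemma supp_le1 : supp_le (fun=> 0%N) 1.
Proof. by move=> m; rewrite msupp1 inE => /eqP -> j; rewrite mnm0E. Qed.

Lemma supp_leZ k (c : R[i]) p : supp_le k p -> supp_le k (c *: p).
Proof. by move=> kp m /msuppZ_le; exact: kp. Qed.

(** T_m evaluated at the [i]-th variable; the pair carries T_m and T_(m+1)
    through the three-term recurrence. *)
Definition cheb (i : 'I_s) (m : nat) : mpoly s R[i] :=
  (iter m (fun pq : mpoly s R[i] * mpoly s R[i] => (pq.2, (2%:R *: mpolyX R[i] (mnm1 i)) * pq.2 - pq.1))
     (1, mpolyX R[i] (mnm1 i))).1.

Definition single (i : 'I_s) (m : nat) : 'I_s -> nat := fun j => if j == i then m else 0%N.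

Lemma cheb_supp i m : supp_le (single i m) (cheb i m).
Proof.
have X1 : supp_le (single i 1) (mpolyX R[i] (mnm1 i)).
  move=> a; rewrite msuppX inE => /eqP -> j; rewrite mnm1E /single eq_sym.
  by case: eqP.
rewrite /cheb; set st := iter m _ _.
suff : supp_le (single i m) st.1 /\ supp_le (single i m.+1) st.2 by case.
rewrite /st {st}; elim: m => [|m [IH1 IH2]] /=.
  split => //; apply: supp_le_trans supp_le1 => j; by rewrite /single.
split=> //; apply: supp_leB.
  apply: supp_le_trans (supp_leM (supp_leZ (c := 2%:R) X1) IH2) => j.
  by rewrite /single; case: eqP.
by apply: supp_le_trans IH1 => j; rewrite /single; case: eqP => // _; rewrite ltnW.
Qed.

Lemma cheb_prod_supp k : supp_le k (\prod_i cheb i (k i)).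
Proof.
have H (r : seq 'I_s) : supp_le (fun j => \sum_(i <- r) single i (k i) j)%N (\prod_(i <- r) cheb i (k i)).
  elim: r => [|i r IH].
    by rewrite big_nil => m /supp_le1 h j; rewrite big_nil.
  rewrite big_cons; apply: supp_le_trans (supp_leM (@cheb_supp i (k i)) IH) => j.
  by rewrite big_cons.
apply: supp_le_trans (H _) => j.
by rewrite (bigD1 j) //= /single eqxx big1 ?addn0 // => i /negbTE ij; rewrite eq_sym ij.
Qed.

Lemma meval_cheb (v : 'I_s -> R[i]) (z : R[i]) i m : z != 0 -> v i = joukowski z ->
  meval v (cheb i m) = cheb_val m z.
Proof.
move=> z0 vi; rewrite /cheb; set st := iter m _ _.
suff : meval v st.1 = cheb_val m z /\ meval v st.2 = cheb_val m.+1 z by case.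
rewrite /st {st}; elim: m => [|m [IH1 IH2]] /=.
  by rewrite cheb_val0 meval1 mevalXU vi /joukowski /cheb_val expr1.
split=> //; rewrite mevalB mevalM mevalZ mevalXU IH1 IH2 vi.
rewrite /joukowski /cheb_val !exprS; field.
by rewrite z0 expf_neq0.
Qed.

End ChebyshevPoly.

(** * Approximation by Fejer means, and geometric sums *)

Section Lipschitz.
Context {R : realType} {s : nat}.
Implicit Types (F : 'rV[R[i]]_s -> R[i]) (z : 'rV[R[i]]_s).

Lemma gauge_torus z : (forall i, normc (z ord0 i) = 1) -> gauge (joukowskiv z) = s%:R.
Proof.
move=> z1; rewrite gauge_joukowskiv => [|i]; last by rewrite -normc_eq0 z1 oner_neq0.
rewrite (eq_bigr (fun=> 1)) ?sumr_const ?card_ord // => i _.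
by rewrite z1 invr1 expr1n -mulr2n mulfV // pnatr_eq0.
Qed.

(** One coordinate is changed at a time, which stays on the torus.  Increments
    shorter than [d] are covered by the first-order expansion, longer ones by
    the bound on [F]. *)
Lemma torus_lipschitz F (e C d : R) : s%:R <= e -> 1 <= C -> 0 < d <= 1 ->
  uniformly_smooth F e C d ->
  exists2 Lp : R, 0 <= Lp & forall z z',
    (forall i, normc (z ord0 i) = 1) -> (forall i, normc (z' ord0 i) = 1) ->
    normc (F (joukowskiv z) - F (joukowskiv z')) <=
      Lp * \sum_i normc (joukowski (z ord0 i) - joukowski (z' ord0 i)).
Proof.
move=> se C1 /andP[d0 d1] HF.
have C0 : 0 <= C by exact: le_trans C1.
have Cd : 0 <= 2 * C / d by rewrite divr_ge0 ?mulr_ge0 // ltW.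
pose Lp := 2 * C + 2 * C / d.
have Lp0 : 0 <= Lp by rewrite addr_ge0 // mulr_ge0.
exists Lp => // z z' z1 z1'.
have step x i u : gauge x <= e -> gauge (set_coord x i u) <= e ->
    normc (F x - F (set_coord x i u)) <= Lp * normc (x ord0 i - u).
  move=> xe ue; have [Fx Fi] := HF x xe; have [Fu _] := HF _ ue.
  have [h|h] := lerP (normc (u - x ord0 i)) d.
    have := nearly_linear_lip C0 d1 (Fi i) h.
    rewrite addr0 set_coord_id [x ord0 i + _]addrC subrK normcB [normc (u - _)]normcB.
    move=> /le_trans; apply; rewrite ler_wpM2r ?normc_ge0 //.
    by rewrite lerDl.
  apply: le_trans (normcB_le Fx Fu) _; rewrite normcB.
  apply: (@le_trans _ _ (2 * C / d * normc (u - x ord0 i))).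
    rewrite mulrAC -[X in _ <= X]mulrA; apply: (@le_trans _ _ (2 * C)); first by lra.
    by rewrite ler_peMr ?mulr_ge0 // ler_pdivlMr // mul1r ltW.
  by rewrite ler_wpM2r ?normc_ge0 // lerDr mulr_ge0.
pose Z m : 'rV[R[i]]_s := \row_i (if (i < m)%N then z' ord0 i else z ord0 i).
have Ze m : gauge (joukowskiv (Z m)) <= e.
  by rewrite gauge_torus // => i; rewrite mxE; case: ifP.
pose D m := \sum_(i < s | (i < m)%N) normc (joukowski (z ord0 i) - joukowski (z' ord0 i)).
suff H m : (m <= s)%N ->
    normc (F (joukowskiv (Z 0%N)) - F (joukowskiv (Z m))) <= Lp * D m.
  have := H s (leqnn s); rewrite /D (eq_bigl xpredT); last by move=> i; rewrite ltn_ord.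
  have -> : Z 0%N = z by apply/rowP => i; rewrite mxE.
  have -> // : Z s = z' by apply/rowP => i; rewrite mxE ltn_ord.
elim: m => [_|m IH ms].
  by rewrite subrr normc0r mulr_ge0 // sumr_ge0 // => i _; rewrite normc_ge0.
pose i := Ordinal ms.
have ZS : joukowskiv (Z m.+1) = set_coord (joukowskiv (Z m)) i (joukowski (z' ord0 i)).
  apply/rowP => j; rewrite set_coordE !mxE ltnS leq_eqVlt.
  have [->|ji] := eqVneq j i; first by rewrite eqxx.
  by rewrite (_ : (val j == m) = false) //; apply/negbTE; exact: ji.
have -> : F (joukowskiv (Z 0%N)) - F (joukowskiv (Z m.+1)) =
   (F (joukowskiv (Z 0%N)) - F (joukowskiv (Z m))) + (F (joukowskiv (Z m)) - F (joukowskiv (Z m.+1))).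
  by ring.
have -> : Lp * D m.+1 = Lp * D m + Lp * normc (joukowski (z ord0 i) - joukowski (z' ord0 i)).
  rewrite -mulrDr /D; congr (_ * _); rewrite (bigD1 i) //= addrC; congr (_ + _).
  apply: eq_bigl => j; rewrite ltnS leq_eqVlt -val_eqE /=.
  by case: eqP => [->|_]; rewrite ?ltnn ?andbT ?andbF.
apply: normcD_le; first by apply: IH; rewrite ltnW.
rewrite ZS; apply: le_trans (step _ i _ (Ze m) _) _; first by rewrite -ZS.
by rewrite mxE [Z m ord0 i]mxE /= ltnn.
Qed.

End Lipschitz.

Section FejerApprox.
Context {R : realType} {s N K : nat}.
Implicit Types (F : 'rV[R[i]]_s -> R[i]) (z : 'rV[R[i]]_s) (w : R[i]).

Definition fejer_mean F w z : R[i] :=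
  grid_mean (N := N) (fun j => F (joukowskiv (torus_pt w (fun=> 1) j)) *
     \prod_i (fejer_kernel K (z ord0 i) (w ^+ j i))%:C).

Lemma grid_prod_mean (g : 'I_s -> 'I_N.+1 -> R) :
  (N.+1%:R^-1) ^+ s * \sum_(j : {ffun 'I_s -> 'I_N.+1}) \prod_i g i (j i) =
  \prod_i (N.+1%:R^-1 * \sum_a g i a).
Proof. by rewrite -(bigA_distr_bigA g) big_split /= prodr_const card_ord. Qed.

(** By positivity and mean 1, the error is at most the mean of the Lipschitz
    bound.  Each distance u is at most eta + u^2 / eta, and the mean of u^2 is
    controlled by the concentration of the kernel in that coordinate, the other
    coordinates having mean 1. *)
Lemma fejer_mean_error F w z (Lp eta : R) : (N.+1).-primitive_root w -> normc w = 1 ->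
  (K <= N)%N -> (forall i, normc (z ord0 i) = 1) -> 0 <= Lp -> 0 < eta ->
  (forall z', (forall i, normc (z' ord0 i) = 1) ->
    normc (F (joukowskiv z) - F (joukowskiv z')) <=
      Lp * \sum_i normc (joukowski (z ord0 i) - joukowski (z' ord0 i))) ->
  normc (F (joukowskiv z) - fejer_mean F w z) <= Lp * (s%:R * (eta + 4 / K.+1%:R / eta)).
Proof.
move=> pw w1 KN z1 Lp0 eta0 HL.
have w1' a : normc (w ^+ a) = 1 by rewrite normcX w1 expr1n.
pose kap i (a : 'I_N.+1) := fejer_kernel K (z ord0 i) (w ^+ a).
have kap0 i a : 0 <= kap i a by exact: fejer_kernel_ge0.
have kap1 i : N.+1%:R^-1 * \sum_a kap i a = 1 by exact: fejer_kernel_mean.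
have N0 : 0 < (N.+1%:R^-1 : R) by rewrite invr_gt0.
have Ns0 : 0 < (N.+1%:R^-1 : R) ^+ s by rewrite exprn_gt0.
pose W (j : {ffun 'I_s -> 'I_N.+1}) := \prod_i kap i (j i).
have W0 j : 0 <= W j by apply: prodr_ge0 => i _.
have W1 : (N.+1%:R^-1) ^+ s * \sum_j W j = 1.
  by rewrite grid_prod_mean big1.
pose u i (a : 'I_N.+1) := normc (joukowski (z ord0 i) - joukowski (w ^+ a)).
have -> : F (joukowskiv z) - fejer_mean F w z =
   grid_mean (fun j => (F (joukowskiv z) - F (joukowskiv (torus_pt w (fun=> 1) j))) * (W j)%:C).
  have e1 : F (joukowskiv z) = grid_mean (N := N) (s := s) (fun j => F (joukowskiv z) * (W j)%:C).
    rewrite /grid_mean -mulr_sumr mulrCA -rmorph_sum.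
    rewrite (_ : N.+1%:R^-1 ^+ s * _ = ((N.+1%:R^-1 ^+ s * \sum_j W j)%:C)).
      by rewrite W1 mulr1.
    by rewrite rmorphM rmorphXn fmorphV rmorph_nat.
  rewrite {1}e1 /fejer_mean grid_meanB; congr (_ * _); apply: eq_bigr => j _.
  by rewrite mulrBl /W rmorph_prod.
rewrite /grid_mean normcM normcX normcV normc_nat.
apply: le_trans (ler_wpM2l (ltW Ns0) (normc_sum _ _ _)) _.
apply: (@le_trans _ _ (N.+1%:R^-1 ^+ s * \sum_(j : {ffun 'I_s -> 'I_N.+1})
    (Lp * \sum_i (W j * eta + W j * u i (j i) ^+ 2 / eta)))).
  rewrite ler_pM2l //; apply: ler_sum => j _.
  rewrite normcM normc_real ger0_norm //.
  have z1j i : normc (torus_pt (N := N) w (fun=> 1) j ord0 i) = 1 by rewrite mxE mul1r.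
  apply: le_trans (ler_wpM2r (W0 j) (HL _ z1j)) _.
  rewrite -mulrA ler_wpM2l // mulr_suml; apply: ler_sum => i _.
  rewrite mxE mul1r -/(u i (j i)) mulrC -mulrA -mulrDr ler_wpM2l //.
  rewrite -subr_ge0 -(pmulr_rge0 _ eta0).
  have -> : eta * (eta + u i (j i) ^+ 2 / eta - u i (j i)) =
     (eta ^+ 2 + u i (j i) ^+ 2 - eta * u i (j i)) by field; rewrite gt_eqF.
  have := sqr_ge0 (eta - u i (j i)); have := sqr_ge0 eta; have := sqr_ge0 (u i (j i)); nra.
rewrite -mulr_sumr mulrCA ler_wpM2l // exchange_big mulr_sumr /=.
apply: (@le_trans _ _ (\sum_(i < s) (eta + 4 / K.+1%:R / eta))); last first.
  by rewrite sumr_const card_ord -[X in X <= _]mulr_natl.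
apply: ler_sum => i _; rewrite big_split /= mulrDr -!mulr_suml mulrA W1 mul1r.
rewrite lerD2l mulrA ler_wpM2r ?invr_ge0 ?(ltW eta0) //.
pose g l a := if l == i then kap l a * u l a ^+ 2 else kap l a.
have gE j : W j * u i (j i) ^+ 2 = \prod_l g l (j l).
  rewrite /W (bigD1 i) //= [RHS](bigD1 i) //= /g eqxx mulrAC; congr (_ * _).
  by apply: eq_bigr => l /negbTE li; rewrite li.
under eq_bigr do rewrite gE.
have P1 : \prod_(l < s | l != i) (N.+1%:R^-1 * \sum_a g l a) = 1.
  by apply: big1 => l /negbTE li; rewrite /g li.
rewrite grid_prod_mean (bigD1 i) //= P1 mulr1.
rewrite mulrC ler_pdivrMr ?ltr0n //.
apply: (@le_trans _ _ (\sum_(a < N.+1) 4 / K.+1%:R)); last first.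
  by rewrite sumr_const card_ord -[X in X <= _]mulr_natr.
by apply: ler_sum => a _; rewrite /g eqxx; exact: fejer_kernel_concentration.
Qed.

Definition gapv (q : {ffun 'I_s -> 'I_K.+1 * 'I_K.+1}) : 'I_s -> nat := fun i => gap (q i).

Lemma fejer_mean_cheb_val F w z : normc w = 1 -> (forall i, normc (z ord0 i) = 1) ->
  fejer_mean F w z = \sum_q (K.+1%:R^-1) ^+ s * grid_coef F N w (gapv q) *
     \prod_i cheb_val (gapv q i) (z ord0 i).
Proof.
move=> w1 z1; rewrite /fejer_mean /grid_coef /grid_mean.
have w1' a : normc (w ^+ a) = 1 by rewrite normcX w1 expr1n.
have kE j : \prod_i (fejer_kernel K (z ord0 i) (w ^+ (j : {ffun 'I_s -> 'I_N.+1}) i))%:C =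
   \sum_q (K.+1%:R^-1) ^+ s * (\prod_i cheb_val (gapv q i) (z ord0 i) * \prod_i cheb_val (gapv q i) (w ^+ j i)).
  under eq_bigr do rewrite fejer_kernelE //.
  rewrite big_split /= prodr_const card_ord -mulr_sumr; congr (_ * _).
  rewrite bigA_distr_bigA; apply: eq_bigr => q _; exact: big_split.
rewrite (eq_bigr _ (fun j _ => congr1 _ (kE j))) /=.
under eq_bigr do rewrite mulr_sumr.
rewrite exchange_big mulr_sumr /=; apply: eq_bigr => q _.
rewrite [X in _ * X * _]mulr_sumr !mulr_sumr mulr_suml.
by apply: eq_bigr => j _; ring.
Qed.

End FejerApprox.

Section Tail.
Context {R : realType}.

(** Each frequency g occurs at most 2 (K + 1) times among the pairs. *)
Lemma gap_geometric_sum_le (mu : R) K : 0 <= mu < 1 ->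
  K.+1%:R^-1 * \sum_(p : 'I_K.+1 * 'I_K.+1) mu ^+ gap p <= 2 / (1 - mu).
Proof.
move=> m01; have [m0 m1] := andP m01.
rewrite -(pair_bigA _ (fun l m : 'I_K.+1 => mu ^+ gap (l, m))) /=.
pose T := \sum_(l < K.+1) \sum_(m < K.+1 | (l <= m)%N) mu ^+ (m - l).
have TE : T <= K.+1%:R * (1 - mu)^-1.
  apply: (@le_trans _ _ (\sum_(l < K.+1) (1 - mu)^-1)); last first.
    by rewrite sumr_const card_ord -[X in X <= _]mulr_natl.
  apply: ler_sum => l _.
  rewrite -(big_geq_mkord l K.+1 xpredT (fun m => mu ^+ (m - l))) /=.
  rewrite -{1}[l : nat]add0n big_addn big_mkord.
  under eq_bigr do rewrite addnK.
  exact: geometric_sum_le.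
have T' : \sum_(l < K.+1) \sum_(m < K.+1 | (m <= l)%N) mu ^+ (l - m) = T.
  rewrite /T; under eq_bigr do rewrite big_mkcond.
  rewrite exchange_big /=; apply: eq_bigr => l _.
  by rewrite [RHS]big_mkcond.
rewrite ler_pdivrMl ?ltr0n //.
apply: (@le_trans _ _ (T + T)); last by move: TE; lra.
rewrite -{1}T' /T -big_split /=; apply: ler_sum => l _.
rewrite [X in _ <= X + _]big_mkcond [X in _ <= _ + X]big_mkcond -big_split /=.
apply: ler_sum => m _; rewrite /gap /=.
have e0 n : 0 <= mu ^+ n by exact: exprn_ge0.
have [h|h] := leqP m l.
  by rewrite (eqP (_ : m - l == 0)%N) ?subn_eq0 // addn0; case: ifP; rewrite ?addr0 ?lerDl.
have lm := ltnW h.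
by rewrite (eqP (_ : l - m == 0)%N) ?subn_eq0 // add0n lm add0r.
Qed.

Lemma gap_box_sum_le (mu : R) s K : 0 <= mu < 1 ->
  \sum_(q : {ffun 'I_s -> 'I_K.+1 * 'I_K.+1}) (K.+1%:R^-1) ^+ s * \prod_i mu ^+ gapv q i <=
  (2 / (1 - mu)) ^+ s.
Proof.
move=> m01; have [m0 m1] := andP m01.
rewrite -mulr_sumr -(bigA_distr_bigA (fun _ p => mu ^+ gap p)) prodr_const card_ord -exprMn.
have S0 : 0 <= \sum_(p : 'I_K.+1 * 'I_K.+1) mu ^+ gap p.
  by apply: sumr_ge0 => p _; exact: exprn_ge0.
rewrite lerXn2r ?nnegrE ?gap_geometric_sum_le //.
  by rewrite mulr_ge0 ?invr_ge0.
by rewrite divr_ge0 // subr_ge0 ltW.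
Qed.

End Tail.

(** * Truncation to a given Euclidean degree *)

Section Approximation.
Context {R : realType} {s : nat}.
Implicit Types (F : 'rV[R[i]]_s -> R[i]) (z : 'rV[R[i]]_s).

Lemma euclid_sum_ge (k : 'I_s -> nat) : (\sum_i k i)%:R <= s%:R * euclid (R := R) k.
Proof.
rewrite natr_sum; apply: le_trans (ler_sum _ (fun i _ => euclid_ge (R := R) k i)) _.
by rewrite sumr_const card_ord -[X in X <= _]mulr_natl.
Qed.

Lemma euclid_mono (k k' : 'I_s -> nat) : (forall i, (k i <= k' i)%N) ->
  euclid (R := R) k <= euclid k'.
Proof.
move=> kk; rewrite ler_wsqrtr //; apply: ler_sum => i _.
by rewrite lerXn2r ?nnegrE // ler_nat.
Qed.

(** Needed because the fineness of the grid in [grid_coef_decay] depends on the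
    frequency, and a single grid must serve for all frequencies of a mean. *)
Lemma common_threshold (I : finType) (P : I -> R -> Prop) :
  (forall q t t', t' <= t -> P q t -> P q t') ->
  (forall q, exists2 t, 0 < t & P q t) -> exists2 t, 0 < t & forall q, P q t.
Proof.
move=> Pm Pe.
suff H (r : seq I) : exists2 t, 0 < t & forall q, q \in r -> P q t.
  by have [t t0 h] := H (enum I); exists t => // q; apply: h; rewrite mem_enum.
elim: r => [|q r [t t0 h]]; first by exists 1.
have [t' t0' h'] := Pe q.
exists (Num.min t t'); first by rewrite lt_min t0.
move=> q'; rewrite inE => /predU1P[->|qr].
  by apply: Pm h'; rewrite ge_min lexx orbT.
by apply: Pm (h _ qr); rewrite ge_min lexx.
Qed.

Lemma fine_root (t : R) (K : nat) : 0 < t -> exists N (w : R[i]),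
  [/\ (N.+1).-primitive_root w, normc w = 1, w != 1, (K <= N)%N & normc (w - 1) <= t].
Proof.
move=> t0; pose k := (K + Num.truncn (4 / t ^+ 2)).+1.
have [w [pw nw wk]] := prim_root_near_one k (R := R).
have kK : (K < 2 ^ k.+1)%N.
  by apply: leq_trans (ltn_expl _ (ltnSn 1)); rewrite ltnS; do 2! apply: leqW; exact: leq_addr.
have EN : ((2 ^ k.+1).-1.+1 = 2 ^ k.+1)%N by rewrite prednK // expn_gt0.
exists (2 ^ k.+1).-1, w; rewrite EN; split => //.
- apply/negP => /eqP w1; have := prim_order_dvd pw 1; rewrite expr1 w1 eqxx dvdn1 => e.
  by have : (1 < 2 ^ k.+1)%N; [rewrite -{1}(expn0 2) ltn_exp2l|rewrite (eqP e)].
- by rewrite -ltnS EN.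
rewrite -(@ler_pXn2r _ 2) ?nnegrE ?normc_ge0 ?(ltW t0) //.
apply: le_trans wk _; rewrite ler_pdivrMr ?exprn_gt0 // mulrC -ler_pdivrMr ?exprn_gt0 //.
apply: le_trans (ltW (truncnS_gt _)) _; rewrite -natrX ler_nat.
by apply: leq_trans (ltnW (ltn_expl _ (ltnSn 1))); rewrite /k ltnS leq_addl.
Qed.

Lemma chebyshev_approximation F (C d y y' : R) : (0 < s)%N -> 1 <= C -> 0 < d <= 1 -> 0 <= y' < y ->
  uniformly_smooth F (s%:R + (expR y - (expR y)^-1) ^+ 2 / 2) C d ->
  exists2 M : R, 0 <= M & forall X : R, 0 <= X ->
    exists p : mpoly s R[i], (forall m, m \in msupp p -> degE m <= X) /\
      forall z, (forall i, normc (z ord0 i) = 1) ->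
        normc (F (joukowskiv z) - meval (joukowskiv z ord0) p) <= M * expR (- (y' * X)).
Proof.
move=> s0 C1 d01 /andP[y'0 yy] HF; have /andP[d0 _] := d01.
have y0 : 0 <= y by lra.
have se : s%:R <= s%:R + (expR y - (expR y)^-1) ^+ 2 / 2.
  by rewrite lerDl divr_ge0 ?sqr_ge0.
have [Lp Lp0 Lip] := torus_lipschitz se C1 d01 HF.
have s0' : 0 < s%:R :> R by rewrite ltr0n.
pose mu := expR (- ((y - y') / s%:R)).
have mu01 : 0 <= mu < 1.
  by rewrite expR_ge0 -expR0 ltr_expR oppr_lt0 divr_gt0 // subr_gt0.
pose Q := (2 / (1 - mu)) ^+ s.
have Q0 : 0 <= Q.
  by rewrite exprn_ge0 // divr_ge0 // subr_ge0 ltW //; case/andP: mu01.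
have C0 : 0 <= C by exact: le_trans C1.
exists (2 + C * Q); first by rewrite addr_ge0 // mulr_ge0.
move=> X X0; set del := expR (- (y' * X)).
have del0 : 0 < del by exact: expR_gt0.
(* K makes the second term of the error of the Fejer mean at most eta, like the
   first one; eps absorbs the total weight (K + 1)^s of the expansion *)
pose eta := del / (2 * (s%:R * Lp + 1)).
have sL0 : 0 < s%:R * Lp + 1 by rewrite ltr_wpDl // mulr_ge0 // ltW.
have eta0 : 0 < eta by rewrite divr_gt0 // mulr_gt0.
pose K := Num.truncn (4 / eta ^+ 2).
have eta2 : 0 < eta * eta by exact: mulr_gt0.
have Keta : 4 / K.+1%:R / eta <= eta.
  rewrite ler_pdivrMr // ler_pdivrMr ?ltr0n // mulrC -ler_pdivrMr //.
  by rewrite -expr2; exact: ltW (truncnS_gt _).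
pose Qt := {ffun 'I_s -> 'I_K.+1 * 'I_K.+1}.
pose eps := del / K.+1%:R ^+ s.
have eps0 : 0 < eps by rewrite divr_gt0 // exprn_gt0.
have [t t0 Ht] : exists2 t : R, 0 < t & forall q : Qt,
    forall N (w : R[i]), w ^+ N.+1 = 1 -> w != 1 -> normc w = 1 -> normc (w - 1) <= t ->
    normc (grid_coef F N w (gapv q)) <= C * expR (- (y * euclid (gapv q))) + eps.
  apply: common_threshold => [q t t' tt h N w wN w1 nw wt|q].
    by apply: h => //; exact: le_trans tt.
  exact: grid_coef_decay C1 d0 y0 HF eps0.
have [N [w [pw nw w1 KN wt]]] := fine_root K t0.
have wN := prim_expr_order pw.
pose c (q : Qt) := (K.+1%:R^-1) ^+ s * grid_coef F N w (gapv q).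
pose p : mpoly s R[i] := \sum_(q : Qt | euclid (gapv q) <= X) c q *: \prod_i cheb i (gapv q i).
exists p.
split=> [m|z z1].
  move/msupp_sum_le => /flattenP[r /mapP[q]]; rewrite mem_filter => /andP[qX _] -> {r}.
  move/msuppZ_le => mq; apply: le_trans qX; apply: (euclid_mono (k := m)).
  exact: cheb_prod_supp mq.
have z0 i : z ord0 i != 0 by exact: unit_neq0.
have -> : meval (joukowskiv z ord0) p =
    \sum_(q : Qt | euclid (gapv q) <= X) c q * \prod_i cheb_val (gapv q i) (z ord0 i).
  rewrite raddf_sum; apply: eq_bigr => q _ /=; rewrite mevalZ rmorph_prod /=; congr (_ * _).
  by apply: eq_bigr => i _; rewrite (meval_cheb (z := z ord0 i)) // mxE.
have h1 := fejer_mean_error pw nw KN z1 Lp0 eta0 (fun z' => @Lip z z' z1).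
have {}h1 : normc (F (joukowskiv z) - fejer_mean (N := N) (K := K) F w z) <= del.
  apply: le_trans h1 _; apply: (@le_trans _ _ (Lp * (s%:R * (2 * eta)))).
    rewrite ler_wpM2l // ler_wpM2l //.
    by rewrite [2 * eta]mulr_natl [eta *+ 2]mulr2n lerD2l.
  have -> : Lp * (s%:R * (2 * eta)) = del * ((s%:R * Lp) / (s%:R * Lp + 1)).
    by rewrite /eta; field; rewrite gt_eqF.
  by rewrite ler_piMr ?(ltW del0) // ler_pdivrMr // mul1r lerDl.
rewrite -[F _](subrK (fejer_mean (N := N) (K := K) F w z)) -addrA.
have -> : (2 + C * Q) * del = del + (C * Q * del + del) by ring.
apply: normcD_le => //.
rewrite fejer_mean_cheb_val // (bigID (fun q : Qt => euclid (gapv q) <= X)) /= addrC addKr.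
apply: le_trans (normc_sum _ _ _) _.
have Ks0 : 0 <= (K.+1%:R^-1 : R) ^+ s by rewrite exprn_ge0 // invr_ge0.
have Pmu0 (q : Qt) : 0 <= \prod_i mu ^+ gapv q i.
  by apply: prodr_ge0 => i _; rewrite exprn_ge0 //; case/andP: mu01.
apply: (@le_trans _ _ (\sum_(q : Qt) ((K.+1%:R^-1) ^+ s * \prod_i mu ^+ gapv q i * (C * del) +
    (K.+1%:R^-1) ^+ s * eps))).
  rewrite [X in _ <= X](bigID (fun q : Qt => euclid (gapv q) <= X)) /=.
  rewrite -[X in X <= _]add0r lerD //.
    apply: sumr_ge0 => q _; apply: addr_ge0; last exact: (mulr_ge0 Ks0 (ltW eps0)).
    by rewrite mulr_ge0 // ?(mulr_ge0 Ks0 (Pmu0 q)) // mulr_ge0 // ltW.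
  apply: ler_sum => q; rewrite -ltNge => qX.
  rewrite normcM -[X in _ <= X]mulr1 ler_pM ?normc_ge0 //; last first.
    rewrite normc_prod; apply: prodr_ile1 => i _.
    by rewrite normc_ge0 cheb_val_le1.
  rewrite normcM normcX normcV normc_nat -!mulrA -mulrDr ler_wpM2l ?exprn_ge0 ?invr_ge0 //.
  apply: le_trans (Ht q N w wN w1 nw wt) _; rewrite lerD2r mulrCA ler_wpM2l //.
  rewrite prodrXr -expRM_natl -expRD ler_expR.
  have := euclid_sum_ge (gapv q); set E := euclid _ in qX *; set S := (\sum_i _)%:R => SE.
  have h : S * ((y - y') / s%:R) <= E * (y - y').
    rewrite mulrA ler_pdivrMr // [X in _ <= X]mulrAC ler_wpM2r ?subr_ge0 ?(ltW yy) //.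
    by rewrite mulrC.
  have : y' * X <= y' * E by rewrite ler_wpM2l // ltW.
  rewrite mulrN; lra.
rewrite big_split /= lerD //.
  rewrite -mulr_suml [X in _ <= X](_ : _ = Q * (C * del)); last by ring.
  by rewrite ler_wpM2r ?mulr_ge0 ?(ltW del0) // gap_box_sum_le.
rewrite sumr_const card_ffun card_prod !card_ord -[X in X <= _]mulr_natr /eps natrX natrM.
rewrite exprVn exprMn le_eqVlt; apply/orP; left; apply/eqP; field.
by rewrite expf_neq0 // pnatr_eq0.
Qed.

End Approximation.

(** * Best approximation on the cube *)

Section Conclusion.
Context {R : realType} {s : nat}.
Implicit Types (F : 'rV[R[i]]_s -> R[i]) (f : 'rV[R]_s -> R[i]).

(** z = x + i sqrt(1 - x^2), whose inverse is its conjugate. *)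
Lemma joukowski_real (x : R) : -1 <= x <= 1 ->
  exists z : R[i], normc z = 1 /\ joukowski z = x%:C.
Proof.
move=> /andP[x1 x2]; exists (x +i* Num.sqrt (1 - x ^+ 2))%C.
have q0 : 0 <= 1 - x ^+ 2 by nra.
have n1 : normc (x +i* Num.sqrt (1 - x ^+ 2))%C = 1.
  by rewrite /normc sqr_sqrtr // addrC subrK sqrtr1.
split=> //; set z := (x +i* _)%C in n1 *.
have -> : joukowski z = (z + z^*%C) / 2%:R.
  congr ((_ + _) / _); apply: (mulfI (unit_neq0 n1)); rewrite mulfV ?unit_neq0 //.
  by rewrite -sqr_normc normc_norm n1 rmorph1 expr1n.
have -> : z + z^*%C = 2%:R * x%:C.
  by rewrite mulr_natl mulr2n; apply/eqP; rewrite eq_complex /= !addr0 subrr !eqxx.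
by rewrite mulrAC mulfV ?two_neq0 ?mul1r.
Qed.

Lemma cube_joukowski (x : 'rV[R]_s) : cube x ->
  exists2 z : 'rV[R[i]]_s, (forall i, normc (z ord0 i) = 1) & joukowskiv z = complexify x.
Proof.
move=> xc; have H i : exists z : R[i], normc z = 1 /\ joukowski z = (x ord0 i)%:C.
  by apply: joukowski_real; have := xc i; rewrite in_itv.
have [z hz] := choice H.
exists (\row_i z i); first by move=> i; rewrite mxE (hz i).1.
by apply/rowP => i; rewrite !mxE (hz i).2.
Qed.

Lemma cube0 : cube (0 : 'rV[R]_s).
Proof. by move=> j; rewrite mxE in_itv /= lerN10 ler01. Qed.

Lemma cube_norm_ge0 (g : 'rV[R]_s -> R[i]) : 0 <= cube_norm g.
Proof.
rewrite /cube_norm; set A := [set _ | _ in _].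
have [hs|hs] := pselect (has_sup A); last by rewrite sup_out.
apply: (@le_trans _ _ (normc (g 0))); first exact: normc_ge0.
by apply: sup_upper_bound hs _ _; exists 0 => //; exact: cube0.
Qed.

Lemma cube_norm_le (g : 'rV[R]_s -> R[i]) (B : R) :
  (forall x, cube x -> normc (g x) <= B) -> cube_norm g <= B.
Proof.
move=> gB; apply: ge_sup; first by exists (normc (g 0)), 0 => //; exact: cube0.
by move=> _ [x xc <-]; exact: gB.
Qed.

Lemma best_error_ge0 (d : multinom s -> R) f n : 0 <= best_error d f n.
Proof.
apply: lb_le_inf.
  exists (cube_norm (fun x => f x - poly_fun 0 x)), 0 => //=.
  by rewrite /poly_deg msupp0 big_nil.
by move=> _ [p _ <-]; exact: cube_norm_ge0.
Qed.

Lemma best_error_le (d : multinom s -> R) f n (p : mpoly s R[i]) (B : R) :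
  (forall m, m \in msupp p -> d m <= n%:R) ->
  (forall x, cube x -> normc (f x - poly_fun p x) <= B) -> best_error d f n <= B.
Proof.
move=> pd pB; apply: le_trans (cube_norm_le pB); apply: ge_inf.
  by exists 0 => _ [q _ <-]; exact: cube_norm_ge0.
exists p => //=; rewrite /poly_deg big_seq; apply: bigmax_le => // m mp; exact: pd.
Qed.

Lemma sinh_ln_rho (h : R) : 0 < h -> let rho := h + Num.sqrt (1 + h ^+ 2) in
  1 < rho /\ rho - rho^-1 = 2 * h.
Proof.
move=> h0; set q := Num.sqrt _ => rho.
have q2 : q ^+ 2 = 1 + h ^+ 2 by rewrite sqr_sqrtr // addr_ge0 // sqr_ge0.
have q1 : 1 <= q.
  rewrite -sqrtr1 ler_wsqrtr // lerDl sqr_ge0 //.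
have rho0 : rho != 0 by rewrite gt_eqF // /rho; lra.
split; first by rewrite /rho; lra.
have -> : rho^-1 = q - h.
  apply: (mulfI rho0); rewrite mulfV // /rho.
  have -> : (h + q) * (q - h) = q ^+ 2 - h ^+ 2 by ring.
  by rewrite q2 addrK.
by rewrite /rho; ring.
Qed.

Lemma region_approximation F f (h y' : R) : (0 < s)%N -> 0 < h ->
  analytic_in (region h) F -> (forall x, cube x -> f x = F (complexify x)) ->
  0 <= y' < ln (h + Num.sqrt (1 + h ^+ 2)) ->
  exists2 M : R, 0 <= M & forall X : R, 0 <= X -> exists p : mpoly s R[i],
    (forall m, m \in msupp p -> degE m <= X) /\
    forall x, cube x -> normc (f x - poly_fun p x) <= M * expR (- (y' * X)).
Proof.
move=> s0 h0 Fan fF; have [] := sinh_ln_rho h0; set rho := h + _ => rho1 rhoh /andP[y'0 y'r].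
have rho0 : 0 < rho by lra.
pose y := (y' + ln rho) / 2.
have [yy yr] : y' < y /\ y < ln rho by rewrite /y; lra.
have ey : expR y < rho by rewrite -[X in _ < X]lnK ?posrE // ltr_expR.
have ey1 : 1 <= expR y by rewrite -expR0 ler_expR; lra.
have ee : s%:R + (expR y - (expR y)^-1) ^+ 2 / 2 < s%:R + 2 * h ^+ 2.
  have h1 : 0 <= expR y - (expR y)^-1.
    by rewrite subr_ge0 (le_trans _ ey1) // invf_le1 // expR_gt0.
  have h2 : expR y - (expR y)^-1 < 2 * h.
    rewrite -rhoh ltrD // ltrN2 ltf_pV2 ?posrE ?expR_gt0 //.
  have : (expR y - (expR y)^-1) ^+ 2 < (2 * h) ^+ 2.
    by rewrite ltrXn2r ?nnegrE // mulr_ge0 // ltW.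
  rewrite exprMn; lra.
have [C [d [C1 d01 HF]]] := uniform_analytic ee (fun x xe => Fan x (gauge_region xe)).
have y'y : 0 <= y' < y by rewrite y'0.
have [M M0 HM] := chebyshev_approximation s0 C1 d01 y'y HF.
exists M => // X X0; have [p [pX pz]] := HM X X0; exists p; split => // x xc.
have [z z1 zx] := cube_joukowski xc.
by rewrite fF // /poly_fun -zx; exact: pz.
Qed.

(** The exponent [y'] is chosen as small as the target [a + e] permits; it is
    then less than [ln rho], and nonnegative even if [a + e] exceeds 1. *)
Lemma best_error_Oeps F f (h c : R) (deg : multinom s -> R) : (0 < s)%N -> 0 < h -> 0 < c ->
  analytic_in (region h) F -> (forall x, cube x -> f x = F (complexify x)) ->
  (forall m (n : nat), degE m <= n%:R * c -> deg m <= n%:R) ->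
  Oeps (best_error deg f) (expR (- (ln (h + Num.sqrt (1 + h ^+ 2)) * c))).
Proof.
move=> s0 h0 c0 Fan fF degc e e0; have [rho1 _] := sinh_ln_rho h0.
set rho := h + _ in rho1 *; set a := expR _.
have a0 : 0 < a by exact: expR_gt0.
have ae0 : 0 < a + e by exact: addr_gt0.
pose y' := Num.max 0 (- ln (a + e) / c).
have y'P : 0 <= y' < ln rho.
  rewrite le_max lexx /= gt_max ln_gt0 //= ltr_pdivrMr // ltrNl.
  by rewrite -[X in X < _]expRK ltr_ln ?posrE // ltrDl.
have y'c : expR (- (y' * c)) <= a + e.
  rewrite -[X in _ <= X]lnK ?posrE // ler_expR lerNl -ler_pdivrMr //.
  by rewrite le_max lexx orbT.
have [M M0 HM] := region_approximation s0 h0 Fan fF y'P.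
apply/eqO_exP; exists (M + 1); first by rewrite ltr_wpDl.
near=> n; rewrite !ger0_norm ?best_error_ge0 ?exprn_ge0 ?(ltW ae0) //.
have [p [pX pB]] := HM (n%:R * c) (mulr_ge0 (ler0n _ n) (ltW c0)).
apply: le_trans (best_error_le _ pB) _; first by move=> m /pX; exact: degc.
apply: ler_pM; rewrite ?expR_ge0 ?lerDl //.
rewrite mulrCA -mulrN expRM_natl lerXn2r ?nnegrE ?expR_ge0 //; exact: ltW.
Unshelve. all: by end_near.
Qed.

Lemma degmax_le_degE (m : multinom s) : degmax (R := R) m <= degE m.
Proof.
rewrite /degmax; apply: (big_ind (fun n => n%:R <= degE m)).
- exact: sqrtr_ge0.
- by move=> a b; rewrite /maxn; case: ifP.
- by move=> j _; exact: (euclid_ge m j).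
Qed.

(** Cauchy-Schwarz, as the nonnegativity of the sum of squared deviations of the
    exponents from their average. *)
Lemma degT_le_degE (m : multinom s) : (0 < s)%N ->
  degT (R := R) m <= Num.sqrt s%:R * degE m.
Proof.
move=> s0; have s0' : 0 < s%:R :> R by rewrite ltr0n.
rewrite /degT /degE -sqrtrM // -[(mdeg m)%:R](@ger0_norm R) // -sqrtr_sqr ler_wsqrtr //.
rewrite mdegE natr_sum; set S := \sum_i _.
have : 0 <= \sum_(i < s) ((m i)%:R - S / s%:R) ^+ 2 by apply: sumr_ge0 => i _; exact: sqr_ge0.
have -> : \sum_(i < s) ((m i)%:R - S / s%:R) ^+ 2 =
   \sum_(i < s) (m i)%:R ^+ 2 - S ^+ 2 / s%:R.
  rewrite (eq_bigr (fun i => (m i)%:R ^+ 2 + (m i)%:R * - (2 * (S / s%:R)) + (S / s%:R) ^+ 2)).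
    rewrite !big_split /= -mulr_suml -/S sumr_const card_ord -[_ *+ s]mulr_natl.
    by field; rewrite gt_eqF.
  by move=> i _; ring.
by rewrite subr_ge0 ler_pdivrMr // mulrC.
Qed.

End Conclusion.

Theorem theorem4p2 (R : realType) (s : nat) (h : R) (f : 'rV[R]_s -> R[i])
    (s_ge1 : (1 <= s)%N) (h_gt0 : 0 < h)
    (f_analytic : exists F : 'rV[R[i]]_s -> R[i],
      analytic_in (region h) F /\
      forall x : 'rV[R]_s, cube x -> f x = F (complexify x)) :
  let rho := h + Num.sqrt (1 + h ^+ 2) in
  [/\ Oeps (best_error degT f) (rho `^ (- (Num.sqrt s%:R)^-1)),
      Oeps (best_error degE f) rho^-1
    & Oeps (best_error degmax f) rho^-1].
Proof.
move=> rho; have [F [Fan fF]] := f_analytic; have [rho1 _] := sinh_ln_rho h_gt0.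
have rho0 : 0 < rho by rewrite /rho; lra.
have rhoV : rho^-1 = expR (- (ln rho * 1)) by rewrite mulr1 expRN lnK.
have q0 : 0 < Num.sqrt s%:R :> R by rewrite sqrtr_gt0 ltr0n.
split.
- rewrite /powR gt_eqF // mulNr mulrC.
  apply: (best_error_Oeps (F := F)) => //; first by rewrite invr_gt0.
  move=> m n mn; apply: le_trans (degT_le_degE m s_ge1) _.
  by rewrite mulrC -ler_pdivlMr.
- by rewrite rhoV; apply: (best_error_Oeps (F := F)) => // m n; rewrite mulr1.
- rewrite rhoV; apply: (best_error_Oeps (F := F)) => // m n; rewrite mulr1.
  exact: le_trans (degmax_le_degE m).
Qed.
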